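(* Let $A\subset \mathbb{Q}\setminus\{0\}$ be a finite set of non-zero rationals and let $k\geq 1$ be a fixed integer. If $\omega(a)+\omega(b)\leq k$ for all $a/b\in A$ with $a,b$ integers and $(a,b)=1$, then $$|A+AA|\geq |A|^{2-o(1)}.$$ Furthermore, if $|A+AA|\leq M|A|^{2}$ then $$\max(|AA|,|A+A|)\geq M^{-O(1)}|A|^{2-o(1)}.$$
   Context: For a non-zero integer $n$, $\omega(n)$ is the number of distinct primes dividing $n$. $A+A=\{a+b: a,b\in A\}$, $AA=\{ab:a,b\in A\}$, $A+AA=\{a_1+a_2a_3: a_1,a_2,a_3\in A\}$. Here $M>0$ is a real number, $o(1)$ denotes a quantity tending to $0$ as $|A|\to\infty$ with $k$ fixed (at a rate depending only on $k$), and $O(1)$ denotes a non-negative quantity bounded above by an absolute constant. *)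

(* Defs.v *)
From HB Require Import structures.
From mathcomp Require Import all_boot all_order all_algebra.
From mathcomp Require Import finmap.
From mathcomp Require Import all_classical all_reals all_analysis.
Set Implicit Arguments.
Unset Strict Implicit.
Unset Printing Implicit Defensive.
Import Order.TTheory GRing.Theory Num.Theory.
Import numFieldNormedType.Exports.
Local Open Scope fset_scope.
Local Open Scope ring_scope.

(* The number of distinct primes dividing n; only meaningful for n != 0
   ([primes 0] is empty). *)
Definition omega (n : int) : nat := size (primes `|n|%N).

Definition sumset (A B : {fset rat}) : {fset rat} :=
  [fset a + b | a in A, b in B].

Definition prodset (A B : {fset rat}) : {fset rat} :=
  [fset a * b | a in A, b in B].

Definition few_prime_factors (k : nat) (A : {fset rat}) : Prop :=
  forall a b : int, b != 0 -> coprimez a b -> a%:Q / b%:Q \in A ->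
    (omega a + omega b <= k)%N.

(* Main.v *)
Require Import Defs.
From HB Require Import structures.
From mathcomp Require Import all_boot all_order all_algebra.
From mathcomp Require Import finmap.
From mathcomp Require Import all_classical all_reals all_analysis.
From mathcomp Require Import zify ring lra.
Set Implicit Arguments.
Unset Strict Implicit.
Unset Printing Implicit Defensive.
Import Order.TTheory GRing.Theory Num.Theory.
Import numFieldNormedType.Exports.
Local Open Scope fset_scope.
Local Open Scope classical_set_scope.
Local Open Scope ring_scope.

(** The argument is elementary, and works up to factors [c * (log |A|) ^ D]
    with [c] and [D] depending on [k] only; below, [<<] hides such factors.
    They are of the form [|A|^o(1)].

    Structure.  Pigeonholing twice ([structured_subset]) replaces [A] by a
    subset, still written [A], of size [N >> |A|], and finds a set [J] of at
    most [k] primes such that every other prime either has constant valuation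
    on [A] or divides (numerators and denominators of) few elements of [A],
    whereas for [p] in [J] no single value of the valuation [v_p] is popular
    on [A].  Each [a] in [A] factors as [a = s b], where [s] is its part at the
    primes of [J] ([smooth_part]) and [b] is the rest ([coprime_part]); let [B]
    be the set of all these [b].

    Products.  The primes outside [J] that matter are rare, so most pairs
    [(a, a')] share none of them, and then [a a'] determines the coprime part
    of [a'] up to boundedly many choices.  Hence [|AA| >> N |B|]
    ([products_lower]).

    Sums.  Let [V] be a finite set of rationals.  Call a level [m] light at
    [y], for the prime [p], if passing from the ball [v_p (x - y) >= m] to the
    ball [v_p (x - y) >= m + 1] loses at least half of the points of [V].  Only
    [log |V|] levels are light at a point of [V].  If [x = y + d] and
    [v_p d = m], the balls of level [m + 1] around [x] and [y] are disjoint
    inside one ball of level [m], so [m] is light at [x] or at [y]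
    ([light_endpoint]).  As no value of [v_p] is popular on [A], for each [y]
    most [a] in [A] have all the levels [v_p a] ([p] in [J]) not light at [y];
    these levels are then light at [x = y + a].  So [x] leaves few choices for
    [s], and at most [|B|] choices for [a] once [s] is known.  This gives
    [|Y + A| >> |Y| N / |B|] ([growth]).  Taking [Y = AA], and using the bound
    on products, [|A + AA| >> N ^ 2], the first claim; taking [Y = A],
    [|A + A| >> N ^ 2 / |B|].

    Second claim.  By these bounds it is enough that, for some [z << M],
    either [|B| <= 4 z] (then [A + A] is large) or [N <= 36 z ^ 3 |B|] (then
    [AA] is large).  Since [x] leaves few choices for [s], Cauchy-Schwarz
    ([energy_lower]) shows that a small [A + AA] produces many triples
    [(y, a, a')] with [y] and [y + a - a'] in [AA] and with [a], [a'] of the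
    same part [s].  Here [a - a' = s (b - b')].  For fixed [b <> b'] and varying
    [s], these differences have distinct vectors of valuations at [J], and
    [edge_count] shows that translations by such numbers rarely keep a finite
    set [V] in place: a family [D] of them has [<< |V| (|D| / K + K ^ 2)] pairs
    [(y, d)] with [y] and [y + d] in [V], for every [K >= 1].  Comparing the
    two bounds ([second_bound]) yields the alternative, so the exponent of [M]
    may be taken to be [3]. *)

(** * Double counting *)

Lemma count_fibers (T U : eqType) (f : T -> U) (us : seq U) (D : seq T) :
  uniq us ->
  count (fun d => f d \in us) D = (\sum_(u <- us) count (fun d => f d == u) D)%N.
Proof.
move=> uu; elim: D => [|d D IH] /=; first by rewrite big1.
rewrite big_split /= IH; congr addn.
rewrite -(count_uniq_mem (f d) uu) -sum1_count big_mkcond /=.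
by apply: eq_bigr => u _; rewrite eq_sym; case: eqP.
Qed.

(** The factor [K] makes it possible to speak of fibres of size at most
    [W / K] without dividing. *)
Lemma count_le_fibers (T U : eqType) (f : T -> U) (P : pred U) (D : seq T) K W :
  (forall u, P u -> (K * count (fun d => f d == u) D <= W)%N) ->
  (K * count (fun d => P (f d)) D <=
   size (undup [seq f d | d <- D & P (f d)]) * W)%N.
Proof.
move=> H; set us := undup _.
have usP u : u \in us -> P u.
  by rewrite mem_undup => /mapP[d]; rewrite mem_filter => /andP[Pd _] ->.
have -> : count (fun d => P (f d)) D = count (fun d => f d \in us) D.
  apply: eq_in_count => d dD; apply/idP/idP => [Pd|/usP //].
  by rewrite mem_undup; apply/mapP; exists d; rewrite // mem_filter Pd.
rewrite count_fibers ?undup_uniq // big_distrr /= -sum1_size big_distrl /=.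
by rewrite big_seq [X in (_ <= X)%N]big_seq leq_sum // => u /usP/H; rewrite mul1n.
Qed.

Lemma sum_count_exchange (T U : Type) (P : T -> U -> bool) (Y : seq T) (A : seq U) :
  (\sum_(y <- Y) count (P y) A = \sum_(a <- A) count (P^~ a) Y)%N.
Proof.
under eq_bigr => y _ do rewrite -sum1_count big_mkcond.
rewrite exchange_big /=; apply: eq_bigr => a _.
by rewrite -sum1_count [RHS]big_mkcond.
Qed.

(** This is how an injective change of variables is performed in a sum. *)
Lemma sum_sub_le (T : eqType) (s t : seq T) (F : T -> nat) :
  uniq s -> {subset s <= t} -> (\sum_(i <- s) F i <= \sum_(i <- t) F i)%N.
Proof.
elim: s t => [|x s IH] t; first by rewrite big_nil.
move=> /= /andP[xs us] st; have xt : x \in t by apply: st; rewrite mem_head.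
rewrite big_cons [X in (_ <= X)%N](big_rem x) //= leq_add2l; apply: IH => // z zs.
have := st z; rewrite inE zs orbT => /(_ isT).
rewrite (perm_mem (perm_to_rem xt)) inE => /orP[/eqP zx|//].
by rewrite -zx zs in xs.
Qed.

Lemma sum_fibers (T U : eqType) (f : T -> U) (D : seq T) (F : T -> nat) :
  (\sum_(d <- D) F d =
   \sum_(u <- undup (map f D)) \sum_(d <- D | f d == u) F d)%N.
Proof.
under [RHS]eq_bigr => u _ do rewrite big_mkcond.
rewrite exchange_big /=; apply: eq_big_seq => d dD.
rewrite (bigD1_seq (f d)) ?undup_uniq ?mem_undup ?map_f //= eqxx big1 ?addn0 //.
by move=> u; rewrite eq_sym => /negPf ->.
Qed.

Lemma count_has_le (S T : eqType) (Q : S -> pred T) (s : seq S) (A : seq T) c N :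
  (forall p, p \in s -> (c * count (Q p) A <= N)%N) ->
  (c * count (fun a => has (Q^~ a) s) A <= size s * N)%N.
Proof.
elim: s => [|p s IH] H /=; first by rewrite count_pred0 muln0.
rewrite mulSn; apply: leq_trans (leq_add (H p (mem_head _ _)) (IH _)).
  rewrite -mulnDr leq_mul2l; apply/orP; right.
  by rewrite -count_predUI leq_addr.
by move=> q qs; apply: H; rewrite inE qs orbT.
Qed.

Lemma cauchy_schwarz_nat (T : Type) (r : seq T) (f : T -> nat) :
  ((\sum_(i <- r) f i) ^ 2 <= size r * \sum_(i <- r) f i ^ 2)%N.
Proof.
rewrite -(@leq_pmul2l 2) //.
have -> : (2 * (\sum_(i <- r) f i) ^ 2 = \sum_(i <- r) \sum_(j <- r) 2 * (f i * f j))%N.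
  rewrite -mulnn big_distrl big_distrr /=; apply: eq_bigr => i _.
  by rewrite !big_distrr.
have -> : (2 * (size r * \sum_(i <- r) f i ^ 2) =
    \sum_(i <- r) \sum_(j <- r) (f i ^ 2 + f j ^ 2))%N.
  have const (c : nat) : (\sum_(i <- r) c = size r * c)%N.
    by rewrite -sum1_size big_distrl /=; apply: eq_bigr => i _; rewrite mul1n.
  rewrite [RHS](eq_bigr (fun i => size r * f i ^ 2 + \sum_(j <- r) f j ^ 2)%N).
    by rewrite big_split /= -big_distrr const /=; lia.
  by move=> i _; rewrite big_split /= const.
by apply: leq_sum => i _; apply: leq_sum => j _; exact: nat_Cauchy.
Qed.

(** * Valuations of rationals *)

Definition vp (p : nat) (q : rat) : int :=
  (logn p `|numq q|)%:Z - (logn p `|denq q|)%:Z.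

(** Cross-multiplying with the reduced form shows that the fraction need not be
    reduced; multiplicativity and the ultrametric inequality follow by writing
    rationals over a suitable denominator. *)
Lemma vp_frac (p : nat) (a b : int) : prime p -> a != 0 -> b != 0 ->
  vp p (a%:~R / b%:~R) = (logn p `|a|)%:Z - (logn p `|b|)%:Z.
Proof.
move=> pp a0 b0; rewrite /vp.
set q : rat := _ / _.
have bQ : (b%:~R : rat) != 0 by rewrite intr_eq0.
have dQ : ((denq q)%:~R : rat) != 0 by rewrite intr_eq0 denq_neq0.
have q0 : q != 0 by rewrite mulf_neq0 ?invr_eq0 // intr_eq0.
have n0 : numq q != 0 by rewrite numq_eq0.
have E : numq q * b = a * denq q.
  apply: (@intr_inj rat); rewrite !rmorphM /=.
  have /eqP := divq_num_den q; rewrite {3}/q.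
  by rewrite eqr_div // => /eqP.
have : logn p `|(numq q * b)%R| = logn p `|(a * denq q)%R| by rewrite E.
rewrite !abszM !lognM ?absz_gt0 ?denq_neq0 //.
move: (logn p `|numq q|) (logn p `|denq q|) (logn p `|a|) (logn p `|b|); lia.
Qed.

Lemma vpM p x y : prime p -> x != 0 -> y != 0 -> vp p (x * y) = vp p x + vp p y.
Proof.
move=> pp x0 y0.
have nx : numq x != 0 by rewrite numq_eq0.
have ny : numq y != 0 by rewrite numq_eq0.
rewrite -{1}(divq_num_den x) -{1}(divq_num_den y) mulf_div -!rmorphM /=.
rewrite vp_frac ?mulf_neq0 ?denq_neq0 // !abszM !lognM ?absz_gt0 ?denq_neq0 //.
rewrite /vp.
move: (logn p `|numq x|) (logn p `|denq x|) (logn p `|numq y|) (logn p `|denq y|).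
lia.
Qed.

Lemma vpN p x : vp p (- x) = vp p x.
Proof. by rewrite /vp numqN denqN abszN. Qed.

Lemma vp1 p : vp p 1 = 0.
Proof. by rewrite /vp /= logn1. Qed.

Lemma vpV p x : prime p -> x != 0 -> vp p x^-1 = - vp p x.
Proof.
move=> pp x0; have := vpM pp x0 (invr_neq0 x0).
by rewrite divff // vp1; lia.
Qed.

Lemma vpXz p x (m : int) : prime p -> x != 0 -> vp p (x ^ m) = m * vp p x.
Proof.
move=> pp x0.
have H (n : nat) : vp p (x ^+ n) = n%:Z * vp p x.
  elim: n => [|n IH]; first by rewrite expr0 vp1 mul0r.
  rewrite exprS vpM // ?expf_neq0 // IH; lia.
case: m => n; first exact: H.
by rewrite NegzE -exprz_inv -exprnP exprVn vpV // ?expf_neq0 // H mulNr.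
Qed.

Lemma vp_prime p q : prime p -> prime q -> vp p q%:R = (p == q)%:Z.
Proof.
move=> pp pq.
have -> : (q%:R : rat) = (q%:Z)%:~R / (1 : int)%:~R by rewrite divr1.
rewrite vp_frac //; last by have := prime_gt0 pq; lia.
by rewrite /= logn1 subr0 logn_prime.
Qed.

(** [z] lies in the [m]-th power of the maximal ideal at [p]; the case
    [z = 0] stands for an infinite valuation. *)
Definition pclose p m (z : rat) := (z == 0) || (m <= vp p z).

Lemma pcloseN p m z : pclose p m (- z) = pclose p m z.
Proof. by rewrite /pclose oppr_eq0 vpN. Qed.

(** The ultrametric inequality, read off the numerators over a common
    denominator. *)
Lemma pcloseD p m x y : prime p -> pclose p m x -> pclose p m y -> pclose p m (x + y).
Proof.
move=> pp; rewrite /pclose.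
have [->|x0 /=] := eqVneq x 0; first by rewrite add0r.
have [->|y0 /=] := eqVneq y 0; first by rewrite addr0 (negPf x0).
have [//|s0 /= mx my] := eqVneq (x + y) 0.
pose d := denq x * denq y; pose a := numq x * denq y; pose b := numq y * denq x.
have dx := denq_neq0 x; have dy := denq_neq0 y.
have d0 : d != 0 by rewrite mulf_neq0.
have dxQ : ((denq x)%:~R : rat) != 0 by rewrite intr_eq0.
have dyQ : ((denq y)%:~R : rat) != 0 by rewrite intr_eq0.
have Ex : x = a%:~R / d%:~R.
  by rewrite -[LHS]divq_num_den /a /d !rmorphM /= -mulf_div divff // mulr1.
have Ey : y = b%:~R / d%:~R.
  rewrite -[LHS]divq_num_den /b /d !rmorphM /=.
  by rewrite [(denq x)%:~R * _]mulrC -mulf_div divff // mulr1.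
have a0 : a != 0 by rewrite mulf_neq0 // numq_eq0.
have b0 : b != 0 by rewrite mulf_neq0 // numq_eq0.
have Es : x + y = (a + b)%:~R / d%:~R by rewrite Ex Ey -mulrDl rmorphD.
have ab0 : a + b != 0.
  by apply: contra_neq s0 => ab; rewrite Es ab mul0r.
move: mx my; rewrite Es {1}Ex {1}Ey !vp_frac //.
set ld := logn p `|d| => mx my.
have key (e : nat) : (e <= logn p `|a|)%N -> (e <= logn p `|b|)%N ->
    (e <= logn p `|(a + b)%R|)%N.
  move=> ea eb; rewrite -pfactor_dvdn ?absz_gt0 //.
  have : ((p ^ e)%N%:Z %| a + b)%Z.
    by rewrite rpredD // dvdzE /= pfactor_dvdn ?absz_gt0.
  by rewrite dvdzE.
have [le|le] := leqP (logn p `|a|) (logn p `|b|).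
  have := key _ (leqnn _) le; lia.
have := key _ (ltnW le) (leqnn _); lia.
Qed.

Lemma pclose_vp p m z : z != 0 -> pclose p m z = (m <= vp p z).
Proof. by rewrite /pclose => /negPf ->. Qed.

Lemma pclose_le p m m' z : m' <= m -> pclose p m z -> pclose p m' z.
Proof. by move=> h; rewrite /pclose; case: (z == 0) => //=; exact: le_trans. Qed.

Definition supp (q : rat) : seq nat := primes `|numq q| ++ primes `|denq q|.

Lemma mem_supp p q : q != 0 -> (p \in supp q) = prime p && (vp p q != 0).
Proof.
move=> q0; rewrite /supp mem_cat !mem_primes !absz_gt0 denq_neq0 numq_eq0 q0 /=.
have [pp|//] := boolP (prime p); rewrite /= /vp.
have h1 : (p %| `|numq q|)%N = (0 < logn p `|numq q|)%N.
  by rewrite logn_gt0 mem_primes pp absz_gt0 numq_eq0 q0.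
have h2 : (p %| `|denq q|)%N = (0 < logn p `|denq q|)%N.
  by rewrite logn_gt0 mem_primes pp absz_gt0 denq_neq0.
have h3 : ~~ ((p %| `|numq q|) && (p %| `|denq q|))%N.
  rewrite -dvdn_gcd (eqP (coprime_num_den q)) dvdn1.
  by apply: contraL pp => /eqP->.
by move: h3; rewrite h1 h2; lia.
Qed.

Lemma supp_uniq q : uniq (supp q).
Proof.
rewrite /supp cat_uniq !primes_uniq /= andbT; apply/hasPn => p.
rewrite !mem_primes => /and3P[pp _ pd]; apply/negP => /and3P[_ _ pn].
have : (p %| gcdn `|numq q| `|denq q|)%N by rewrite dvdn_gcd pn pd.
by rewrite (eqP (coprime_num_den q)) dvdn1; apply/negP; apply: contraL pp => /eqP->.
Qed.

(** A quotient of two such numbers has no prime in its numerator or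
    denominator, hence is [1] or [-1]. *)
Lemma vp_inj x y : x != 0 -> y != 0 -> (0 < x) = (0 < y) ->
  (forall p, prime p -> vp p x = vp p y) -> x = y.
Proof.
move=> x0 y0 sg H.
pose z := x / y.
have z0 : z != 0 by rewrite mulf_neq0 ?invr_eq0.
have Hz p : prime p -> vp p z = 0.
  by move=> pp; rewrite vpM ?invr_eq0 // vpV // H // subrr.
have S0 : supp z = [::].
  case E : (supp z) => [//|p s].
  have : p \in supp z by rewrite E mem_head.
  by rewrite mem_supp // => /andP[pp]; rewrite Hz.
have n1 : `|numq z|%N = 1%N.
  move: (congr1 size S0) => /eqP; rewrite size_cat addn_eq0 => /andP[/nilP/eqP pn _].
  move: pn; rewrite primes_eq0; have : (0 < `|numq z|)%N by rewrite absz_gt0 numq_eq0.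
  lia.
have d1 : `|denq z|%N = 1%N.
  move: (congr1 size S0) => /eqP; rewrite size_cat addn_eq0 => /andP[_ /nilP/eqP pn].
  move: pn; rewrite primes_eq0; have : (0 < `|denq z|)%N by rewrite absz_gt0 denq_neq0.
  lia.
have D1 : denq z = 1 by have := denq_gt0 z; lia.
have : z = 1 \/ z = -1.
  rewrite -[z]divq_num_den D1 divr1; have := numq_eq0 z; rewrite (negPf z0).
  have [->|->] : numq z = 1 \/ numq z = -1 by lia.
    by left.
  by right.
case=> E; have : x = z * y by rewrite /z divfK.
- by rewrite E mul1r.
- rewrite E mulN1r => xy; move: sg; rewrite xy oppr_gt0.
by case: ltgtP y0.
Qed.

(** * Balls in a finite set of rationals and their light levels *)

Definition pball (V : seq rat) p (m : int) (y : rat) := count (fun x => pclose p m (x - y)) V.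

Definition light (V : seq rat) p (m : int) (y : rat) := (2 * pball V p (m + 1) y <= pball V p m y)%N.

(** The balls of level [m + 1] around [y] and [y + d] are disjoint, and both
    lie in the common ball of level [m]: they cannot both contain more than
    half of it. *)
Lemma light_endpoint V p (y d : rat) : prime p -> d != 0 ->
  light V p (vp p d) y || light V p (vp p d) (y + d).
Proof.
move=> pp d0; set m := vp p d.
have nd : pclose p m d by rewrite pclose_vp.
have e1 (x : rat) : x - y = (x - (y + d)) + d by ring.
have e2 (x : rat) : x - (y + d) = (x - y) + - d by ring.
have e3 (x : rat) : d = (x - y) + - (x - (y + d)) by ring.
have same : pball V p m (y + d) = pball V p m y.
  apply: eq_count => x /=; apply/idP/idP => h.
    by rewrite e1 pcloseD.
  by rewrite e2 pcloseD ?pcloseN.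
have sum : (pball V p (m + 1) y + pball V p (m + 1) (y + d) <= pball V p m y)%N.
  rewrite /pball -count_predUI [X in (_ + X)%N](_ : _ = 0%N).
    rewrite addn0; apply: sub_count => x /= /orP[] h.
      by apply: pclose_le h; lia.
    rewrite e1 pcloseD //.
    by apply: pclose_le h; lia.
  apply/eqP; rewrite -leqn0 leqNgt -has_count; apply/hasPn => x _ /=.
  apply/negP => /andP[h1 h2].
  have : pclose p (m + 1) d.
    by rewrite (e3 x) pcloseD ?pcloseN.
  by rewrite pclose_vp // /m; lia.
rewrite /light same; lia.
Qed.

(** The ball around [y] halves at each light level, and it never becomes empty
    because [y] itself belongs to [V]. *)
Lemma light_levels V p y ms L : y \in V -> (size V <= 2 ^ L)%N ->
  uniq ms -> all (fun m => light V p m y) ms -> (size ms <= L)%N.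
Proof.
move=> yV sV ums lms.
have aux m s : path <%O m s -> all (fun m => light V p m y) (m :: s) ->
    (2 ^ (size s).+1 <= pball V p m y)%N.
  elim: s m => [|m' s IH] m /=.
    rewrite andbT => _; apply: leq_trans.
    suff : (0 < pball V p (m + 1) y)%N by lia.
    by rewrite -has_count; apply/hasP; exists y; rewrite // /pclose subrr eqxx.
  move=> /andP[mm' pm'] /andP[lm lm']; have := IH m' pm' lm'.
  have : (pball V p m' y <= pball V p (m + 1) y)%N.
    by apply: sub_count => x; apply: pclose_le; lia.
  move: lm; rewrite /light [in (2 ^ (size s).+2)%N]expnS; lia.
rewrite -(size_sort <=%O).
have : sorted <%O (sort <=%O ms) by rewrite lt_sorted_uniq_le sort_uniq ums sort_le_sorted.
have : all (fun m => light V p m y) (sort <=%O ms) by rewrite all_sort.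
case: (sort _ ms) => [//|m s] ls ss.
have h := aux m s ss ls; rewrite -ltnS -(@ltn_exp2l 2) //=.
apply: leq_ltn_trans h _; apply: leq_ltn_trans (count_size _ _) _.
by apply: leq_ltn_trans sV _; rewrite ltn_exp2l.
Qed.

(** The vector [u] of levels is indexed by the primes of [J]. *)
Definition all_light V (J : seq nat) (y : rat) (u : seq int) :=
  all2 (fun p m => light V p m y) J u.

(** Induction on [J]: group the vectors by their first level. *)
Lemma light_words V J y us L : y \in V -> (size V <= 2 ^ L)%N ->
  uniq us -> all (all_light V J y) us -> (size us <= L ^ size J)%N.
Proof.
move=> yV sV; elim: J us => [|p J IH] us uus /allP lus /=.
  have us0 u : u \in us -> u = [::] by move/lus; case: u.
  case: us uus us0 {lus} => [//|u [//|v us]] uus us0.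
  have eu : u = [::] by apply: us0; rewrite mem_head.
  have ev : v = [::] by apply: us0; rewrite !inE eqxx orbT.
  by move: uus; rewrite eu ev.
have pos u : u \in us -> u = head 0 u :: behead u by move/lus; case: u.
have -> : size us = count (fun u => predT (head 0 u)) us by rewrite count_predT.
rewrite -[count _ _]mul1n; apply: leq_trans (@count_le_fibers _ _ _ _ _ 1 (L ^ size J) _) _.
  move=> m _; rewrite mul1n -size_filter -(size_map behead); apply: IH.
    rewrite map_inj_in_uniq ?filter_uniq // => u v; rewrite !mem_filter.
    move=> /andP[/eqP hu uu] /andP[/eqP hv vu] e.
    by rewrite (pos u) // (pos v) // hu hv e.
  apply/allP => w /mapP[u]; rewrite mem_filter => /andP[_ uu] ->.
  by move: (lus u uu); rewrite {1}(pos u) // /all_light /= => /andP[].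
rewrite expnS leq_mul2r; apply/orP; right.
apply: (light_levels (V := V) (p := p) (y := y)); rewrite ?undup_uniq //.
apply/allP => m; rewrite mem_undup => /mapP[u]; rewrite mem_filter => /= uu ->.
by move: (lus u uu); rewrite {1}(pos u) // /all_light /= => /andP[].
Qed.

(** * Sums with a set that is spread out at the primes of J *)

Definition vals (J : seq nat) (a : rat) : seq int := [seq vp p a | p <- J].

Lemma all_light_vals V J y a :
  all_light V J y (vals J a) = all (fun p => light V p (vp p a) y) J.
Proof. by rewrite /all_light /vals; elim: J => //= p J ->. Qed.

(** The bound [k] stands for the number of primes in [J] and [L] for the number
    of light levels at a point: the normalization makes light levels at a given
    point account for at most half of [A]. *)
Definition thin_slices (A : seq rat) (J : seq nat) k L :=
  forall p m, p \in J -> (2 * k * L * count (fun a => vp p a == m) A <= size A)%N.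

Lemma half_not_light (A V : seq rat) (J : seq nat) k L y :
  (0 < k)%N -> (0 < L)%N -> (size J <= k)%N ->
  thin_slices A J k L ->
  y \in V -> (size V <= 2 ^ L)%N ->
  (size A <= 2 * count (fun a => all (fun p => ~~ light V p (vp p a) y) J) A)%N.
Proof.
move=> k0 L0 Jk slice yV sV.
have bad p : p \in J ->
    (2 * k * count (fun a => light V p (vp p a) y) A <= size A)%N.
  move=> pJ; rewrite -(@leq_pmul2l L) // mulnA [(L * _)%N]mulnC.
  apply: leq_trans (count_le_fibers (P := fun m => light V p m y) (W := size A) _) _.
    by move=> m _; apply: slice.
  rewrite leq_mul2r; apply/orP; right.
  apply: (light_levels (V := V) (p := p) (y := y)); rewrite ?undup_uniq //.
  by apply/allP => m; rewrite mem_undup => /mapP[u]; rewrite mem_filter => /andP[? _] ->.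
have tot := count_has_le (Q := fun p a => light V p (vp p a) y) bad.
have {}tot : (2 * count (fun a => has (fun p => light V p (vp p a) y) J) A <= size A)%N.
  rewrite -(@leq_pmul2l k) // mulnA [(k * 2)%N]mulnC; apply: leq_trans tot _.
  by rewrite leq_mul2r Jk orbT.
have := count_predC (fun a => has (fun p => light V p (vp p a) y) J) A.
rewrite (@eq_count _ (predC _) (fun a => all (fun p => ~~ light V p (vp p a) y) J)).
  lia.
by move=> a /=; rewrite -all_predC.
Qed.

(** Representations of [x] as an element of [Y] plus an element of [A] with
    prescribed valuations at [J]. *)
Definition reps_with_vals J (A Y : seq rat) x u :=
  count (fun a => (vals J a == u) && ((x - a)%R \in Y)) A.

Definition light_vals V J (A : seq rat) x :=
  undup [seq vals J a | a <- A & all_light V J x (vals J a)].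

Lemma size_light_vals V J A x L : x \in V -> (size V <= 2 ^ L)%N ->
  (size (light_vals V J A x) <= L ^ size J)%N.
Proof.
move=> xV sV; apply: (light_words (V := V) (y := x)); rewrite ?undup_uniq //.
by apply/allP => u; rewrite mem_undup => /mapP[a]; rewrite mem_filter => /andP[? _] ->.
Qed.

(** For each [y], at least half of the [a] have no level light at [y]; by
    [light_endpoint] their levels are light at [y + a], so that these pairs are
    among the representations counted on the right. *)
Lemma light_reps_total (A V X Y : seq rat) (J : seq nat) k L :
  (0 < k)%N -> (0 < L)%N -> (size J <= k)%N -> all prime J ->
  thin_slices A J k L ->
  0 \notin A -> uniq Y ->
  {subset Y <= V} -> (size V <= 2 ^ L)%N ->
  (forall y a, y \in Y -> a \in A -> y + a \in X) ->
  (size Y * size A <=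
   2 * \sum_(x <- X) \sum_(u <- light_vals V J A x) reps_with_vals J A Y x u)%N.
Proof.
move=> k0 L0 Jk Jp slice A0 uY YV sV YA.
pose good y a := all (fun p => ~~ light V p (vp p a) y) J.
have h1 : (size Y * size A <= 2 * \sum_(y <- Y) count (good y) A)%N.
  rewrite -sum1_size big_distrl big_distrr /= big_seq [X in (_ <= X)%N]big_seq.
  apply: leq_sum => y yY; rewrite mul1n.
  by apply: half_not_light L0 Jk slice _ sV => //; apply: YV.
apply: leq_trans h1 _; rewrite leq_mul2l /= sum_count_exchange.
have -> : (\sum_(x <- X) \sum_(u <- light_vals V J A x) reps_with_vals J A Y x u =
   \sum_(x <- X) count (fun a => (vals J a \in light_vals V J A x) && ((x - a)%R \in Y)) A)%N.
  apply: eq_bigr => x _; rewrite /reps_with_vals.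
  under eq_bigr => u _ do rewrite -count_filter.
  by rewrite -count_fibers ?undup_uniq // count_filter.
rewrite [X in (_ <= X)%N]sum_count_exchange big_seq [X in (_ <= X)%N]big_seq.
apply: leq_sum => a aA /=.
have a0 : a != 0 by apply: contraNneq A0 => <-.
rewrite -!size_filter -(size_map (fun y => y + a)); apply: uniq_leq_size.
  by rewrite map_inj_uniq ?filter_uniq //; apply: addIr.
move=> x /mapP[y]; rewrite mem_filter => /andP[/allP gy yY] ->.
rewrite mem_filter YA // andbT addrK yY andbT mem_undup; apply/mapP; exists a => //.
rewrite mem_filter aA andbT all_light_vals; apply/allP => p pJ.
have := light_endpoint V y (allP Jp p pJ) a0.
by rewrite (negPf (gy p pJ)).
Qed.

(** Each [x] is counted by at most [L ^ k] vectors of light levels, and each of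
    them by at most [b] elements of [A]. *)
Lemma growth (A V X Y : seq rat) (J : seq nat) k L b :
  (0 < k)%N -> (0 < L)%N -> (size J <= k)%N -> all prime J ->
  thin_slices A J k L ->
  0 \notin A -> uniq Y ->
  {subset Y <= V} -> {subset X <= V} -> (size V <= 2 ^ L)%N ->
  (forall y a, y \in Y -> a \in A -> y + a \in X) ->
  (forall u, count (fun a => vals J a == u) A <= b)%N ->
  (size Y * size A <= 2 * L ^ k * b * size X)%N.
Proof.
move=> k0 L0 Jk Jp slice A0 uY YV XV sV YA hb.
apply: leq_trans (light_reps_total k0 L0 Jk Jp slice A0 uY YV sV YA) _.
rewrite -!mulnA leq_mul2l /= -sum1_size !big_distrr /= big_seq [X in (_ <= X)%N]big_seq.
apply: leq_sum => x xX; rewrite muln1.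
apply: (@leq_trans (\sum_(u <- light_vals V J A x) b)%N).
  apply: leq_sum => u _; apply: leq_trans (hb u).
  by apply: sub_count => a /andP[].
rewrite -[X in (X <= _)%N](_ : size (light_vals V J A x) * b = _)%N; last first.
  by rewrite -sum1_size big_distrl /=; apply: eq_bigr => u _; rewrite mul1n.
rewrite leq_mul2r; apply/orP; right.
by apply: leq_trans (size_light_vals J A (XV _ xX) sV) _; rewrite leq_pexp2l.
Qed.

Definition energy J (A Y : seq rat) :=
  (\sum_(y <- Y) \sum_(a <- A)
     count (fun a' => (vals J a' == vals J a) && ((y + a - a')%R \in Y)) A)%N.

(** Cauchy-Schwarz, first over the at most [L ^ k] light vectors of each [x],
    then over [X].  Restricting to light vectors before squaring is what avoids
    a factor equal to the number of all vectors of valuations. *)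
Lemma energy_lower (A V X Y : seq rat) (J : seq nat) k L :
  (0 < k)%N -> (0 < L)%N -> (size J <= k)%N -> all prime J ->
  thin_slices A J k L ->
  0 \notin A -> uniq Y -> uniq X ->
  {subset Y <= V} -> {subset X <= V} -> (size V <= 2 ^ L)%N ->
  (forall y a, y \in Y -> a \in A -> y + a \in X) ->
  ((size Y * size A) ^ 2 <= 4 * size X * L ^ k * energy J A Y)%N.
Proof.
move=> k0 L0 Jk Jp slice A0 uY uX YV XV sV YA.
have tot := light_reps_total k0 L0 Jk Jp slice A0 uY YV sV YA.
have {}tot : ((size Y * size A) ^ 2 <=
    (2 * \sum_(x <- X) \sum_(u <- light_vals V J A x) reps_with_vals J A Y x u) ^ 2)%N.
  by rewrite leq_exp2r.
apply: leq_trans tot _; rewrite expnMn (_ : 2 ^ 2 = 4)%N // -!mulnA leq_mul2l /=.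
apply: leq_trans (cauchy_schwarz_nat _ _) _.
rewrite leq_mul2l; apply/orP; right.
have cs x : x \in X -> ((\sum_(u <- light_vals V J A x) reps_with_vals J A Y x u) ^ 2 <=
    L ^ k * \sum_(a <- A | (x - a)%R \in Y)
       count (fun a' => (vals J a' == vals J a) && ((x - a')%R \in Y)) A)%N.
  move=> xX; apply: leq_trans (cauchy_schwarz_nat _ _) _.
  apply: leq_mul.
    by apply: leq_trans (size_light_vals J A (XV _ xX) sV) _; rewrite leq_pexp2l.
  have E u : (reps_with_vals J A Y x u ^ 2 = \sum_(a <- A | (x - a)%R \in Y)
      (vals J a == u) * count (fun a' => (vals J a' == vals J a) && ((x - a')%R \in Y)) A)%N.
    rewrite -mulnn {1}/reps_with_vals -sum1_count big_distrl /= [RHS]big_mkcond [LHS]big_mkcond /=.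
    apply: eq_bigr => a _; case: eqP => [->|_] /=; first by rewrite !mul1n.
    by case: ifP.
  under eq_bigr => u _ do rewrite E.
  rewrite exchange_big /=; apply: leq_sum => a _.
  rewrite -big_distrl /= -[X in (_ <= X)%N]mul1n leq_mul2r; apply/orP; right.
  under eq_bigr => u _ do rewrite eq_sym -[nat_of_bool _]/(nat_of_bool (pred1 (vals J a) u)).
  rewrite (_ : (\sum_(i <- _) _)%N = count (pred1 (vals J a)) (light_vals V J A x)).
    by rewrite count_uniq_mem ?undup_uniq // leq_b1.
  by rewrite -sum1_count [RHS]big_mkcond; apply: eq_bigr => u _; case: (pred1 _ _).
apply: (@leq_trans (\sum_(x <- X) L ^ k * \sum_(a <- A | (x - a)%R \in Y)
       count (fun a' => (vals J a' == vals J a) && ((x - a')%R \in Y)) A)%N).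
  by rewrite big_seq [X in (_ <= X)%N]big_seq; apply: leq_sum => x /cs.
rewrite -big_distrr leq_mul2l /=; apply/orP; right.
rewrite /energy.
under eq_bigr => x _ do rewrite big_mkcond.
rewrite exchange_big [X in (_ <= X)%N]exchange_big /=.
apply: leq_sum => a _; rewrite -big_mkcond /= -big_filter.
pose F y := count (fun a' => (vals J a' == vals J a) && (y + a - a' \in Y)) A.
rewrite (_ : (\sum_(x <- _) _ = \sum_(y <- [seq (x - a)%R | x <- [seq i <- X | (i - a)%R \in Y]]) F y)%N).
  apply: sum_sub_le.
    by rewrite map_inj_uniq ?filter_uniq //; apply: addIr.
  by move=> y /mapP[x]; rewrite mem_filter => /andP[? _] ->.
by rewrite big_map; apply: eq_bigr => x _; rewrite /F subrK.
Qed.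

(** * Translations that keep a finite set in place *)

Lemma mem_mask_negb (T : eqType) (m : bitseq) (s : seq T) x : size m = size s ->
  x \in s -> (x \in mask m s) || (x \in mask (map negb m) s).
Proof.
elim: s m => [|y s IH] [|b m] //= [] sm; rewrite !inE => /orP[/eqP->|xs].
  by case: b; rewrite /= mem_head ?orbT.
by case: b; rewrite /= inE; case/orP: (IH m sm xs) => ->; rewrite ?orbT.
Qed.

Lemma eq_valsP J d d' : reflect {in J, forall p, vp p d = vp p d'} (vals J d == vals J d').
Proof. by apply: (iffP eqP) => /eq_in_map. Qed.

Definition fibre J (D : seq rat) d := count (fun d' => vals J d' == vals J d) D.

(** There are at most [K |D| / W] popular vectors at [J1], and as many at [J2],
    with [W = |D| + K ^ 3]; a pair of vectors determines [d].  So at most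
    [(K |D| / W) ^ 2] elements are popular on both sides, which is at most
    [|D| / (4 K)] because [W ^ 2 >= 4 |D| K ^ 3]. *)
Lemma popular_both J1 J2 (D : seq rat) K : uniq D -> (0 < K)%N ->
  {in D &, forall d d', vals J1 d = vals J1 d' -> vals J2 d = vals J2 d' -> d = d'} ->
  (K * count (fun d => (size D + K ^ 3 < K * fibre J1 D d) &&
                       (size D + K ^ 3 < K * fibre J2 D d)) D <= size D)%N.
Proof.
move=> uD K0 inj; set W := (size D + K ^ 3)%N.
pose U J := undup [seq vals J d | d <- D & (W < K * fibre J D d)%N].
have sU J : (size (U J) * W <= K * size D)%N.
  apply: (@leq_trans (K * count (fun d => vals J d \in U J) D)); last first.
    by rewrite leq_mul2l count_size orbT.
  rewrite count_fibers ?undup_uniq // -sum1_size big_distrl big_distrr /=.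
  rewrite big_seq [X in (_ <= X)%N]big_seq; apply: leq_sum => u; rewrite mul1n.
  by rewrite mem_undup => /mapP[d]; rewrite mem_filter => /andP[/ltnW ? _] ->.
set bad := count _ D.
have sbad : (bad <= size (U J1) * size (U J2))%N.
  rewrite -(size_allpairs pair) /bad -size_filter.
  rewrite -(size_map (fun d => (vals J1 d, vals J2 d))); apply: uniq_leq_size.
    rewrite map_inj_in_uniq ?filter_uniq // => d d'.
    rewrite !mem_filter => /andP[_ dD] /andP[_ d'D] [] e1 e2.
    exact: inj.
  move=> v /mapP[d]; rewrite mem_filter => /andP[/andP[d1 d2] dD] ->.
  apply/allpairsP; exists (vals J1 d, vals J2 d); split=> //=.
    by rewrite mem_undup; apply/mapP; exists d; rewrite // mem_filter d1.
  by rewrite mem_undup; apply/mapP; exists d; rewrite // mem_filter d2.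
have [D0|Dpos] := posnP (size D).
  by rewrite /bad (size0nil D0) muln0.
have h : (bad * (W * W) <= (K * size D) * (K * size D))%N.
  apply: leq_trans (leq_mul (sU J1) (sU J2)).
  by rewrite mulnACA leq_mul2r sbad orbT.
have h2 : (4 * (size D * K ^ 3) <= W * W)%N.
  rewrite /W; move: (size D) (K ^ 3)%N (nat_Cauchy (size D) (K ^ 3)).1 => a c.
  by rewrite mulnn sqrnD; lia.
have h3 : (bad * (4 * (size D * K ^ 3)) <= (K * size D) * (K * size D))%N.
  by apply: leq_trans h; rewrite leq_mul2l h2 orbT.
have {h3} : ((K * K * size D) * (4 * K * bad) <= (K * K * size D) * size D)%N.
  move: h3 {sbad h h2}; move: bad (size D) => a c.
  rewrite (_ : a * (4 * (c * K ^ 3)) = K * K * c * (4 * K * a))%N; last by ring.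
  by rewrite (_ : K * c * (K * c) = K * K * c * c)%N; last by ring.
rewrite leq_pmul2l ?muln_gt0 ?K0 // -mulnA => h4.
by apply: leq_trans h4; rewrite leq_pmull.
Qed.

(** The light levels at [y] leave at most [L ^ |J|] vectors, each of which is
    taken by few [d] as only small fibres are counted. *)
Lemma rare_edges J (D V : seq rat) L K W y :
  y \in V -> (size V <= 2 ^ L)%N ->
  (K * count (fun d => all_light V J y (vals J d) && (K * fibre J D d <= W)) D
     <= L ^ size J * W)%N.
Proof.
move=> yV sV.
pose P u := all_light V J y u && (K * count (fun d' => vals J d' == u) D <= W)%N.
apply: leq_trans (@count_le_fibers _ _ (vals J) P D K W _) _; first by move=> u /andP[].
rewrite leq_mul2r; apply/orP; right.
apply: (light_words (V := V) (y := y)); rewrite ?undup_uniq //.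
apply/allP => u; rewrite mem_undup => /mapP[d].
by rewrite mem_filter => /andP[/andP[]] + _ _ ->.
Qed.

Lemma shift_sum (D V : seq rat) (P : rat -> rat -> bool) : uniq V ->
  (\sum_(y <- V) count (fun d => ((y + d)%R \in V) && P (y + d)%R d) D <=
   \sum_(x <- V) count (P x) D)%N.
Proof.
move=> uV; rewrite sum_count_exchange [X in (_ <= X)%N]sum_count_exchange.
apply: leq_sum => d _; rewrite -!size_filter -(size_map (fun y => y + d)).
apply: uniq_leq_size; first by rewrite map_inj_uniq ?filter_uniq //; apply: addIr.
move=> x /mapP[y]; rewrite mem_filter => /andP[/andP[yV Py] _] ->.
by rewrite mem_filter Py.
Qed.

(** An edge from [y] to [y + d] is light at [y] for the primes of some subset
    [I] of [J], and light at [y + d] for the other ones.  If the valuations of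
    [d] on [I], or those on the complement of [I], are rare in [D], then [y],
    respectively [y + d], leaves few choices for [d] ([rare_edges]).  Otherwise
    [d] is one of the few elements of [popular_both].  Distinctness of the
    valuation vectors is essential: it rules out, for instance, that [D] is a
    long interval. *)
Lemma edge_count (D V : seq rat) J k L K :
  uniq D -> 0 \notin D -> {in D &, injective (vals J)} -> all prime J ->
  (size J <= k)%N -> (0 < L)%N -> (0 < K)%N -> uniq V -> (size V <= 2 ^ L)%N ->
  (K * \sum_(y <- V) count (fun d => (y + d)%R \in V) D <=
   3 * (2 * L) ^ k * size V * (size D + K ^ 3))%N.
Proof.
move=> uD D0 inj Jp Jk L0 K0 uV sV; set W := (size D + K ^ 3)%N.
set r := size J in Jk *.
pose t1 (J' : seq nat) y d := all_light V J' y (vals J' d) && (K * fibre J' D d <= W)%N.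
pose t3 (m : r.-tuple bool) d :=
  (W < K * fibre (mask m J) D d)%N && (W < K * fibre (mask (map negb m) J) D d)%N.
have bound1 J' : (size J' <= r)%N ->
    (K * \sum_(y <- V) count (t1 J' y) D <= size V * (L ^ k * W))%N.
  move=> J'r; rewrite -sum1_size big_distrl big_distrr /= big_seq [X in (_ <= X)%N]big_seq.
  apply: leq_sum => y yV; rewrite mul1n.
  apply: leq_trans (rare_edges J' D K W yV sV) _.
  by rewrite leq_mul2r leq_pexp2l ?orbT // (leq_trans J'r).
have bound3 m : (K * \sum_(y <- V) count (t3 m) D <= size V * (L ^ k * W))%N.
  rewrite -sum1_size big_distrl big_distrr /=; apply: leq_sum => y _; rewrite mul1n.
  apply: (@leq_trans (1 * W)); last by rewrite leq_mul2r expn_gt0 L0 orbT.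
  rewrite mul1n; apply: leq_trans (leq_addr _ _); apply: popular_both => //.
  move=> d d' dD d'D /eqP/eq_valsP e1 /eqP/eq_valsP e2; apply: inj => //.
  apply/eqP/eq_valsP => p pJ.
  have : size m = size J by rewrite size_tuple.
  by move/mem_mask_negb/(_ pJ)/orP => [/e1|/e2].
have mask_r (m : bitseq) : size m = r -> (size (mask m J) <= r)%N.
  by move=> sm; rewrite size_mask // -sm count_size.
have split_edges : (\sum_(y <- V) count (fun d => (y + d)%R \in V) D <=
   \sum_(m : r.-tuple bool) (\sum_(y <- V) count (t1 (mask m J) y) D +
     \sum_(y <- V) count (t1 (mask (map negb m) J) y) D +
     \sum_(y <- V) count (t3 m) D))%N.
  pose t2 m y d := ((y + d)%R \in V) && t1 (mask (map negb m) J) (y + d) d.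
  apply: (@leq_trans (\sum_(m : r.-tuple bool) (\sum_(y <- V) count (t1 (mask m J) y) D +
     \sum_(y <- V) count (t2 m y) D +
     \sum_(y <- V) count (t3 m) D))%N); last first.
    apply: leq_sum => m _; rewrite leq_add2r leq_add2l; exact: shift_sum.
  have countE (P : pred rat) : (count P D = \sum_(d <- D) P d)%N.
    by rewrite -sum1_count big_mkcond.
  have E m : (\sum_(y <- V) count (t1 (mask (m : r.-tuple bool) J) y) D +
     \sum_(y <- V) count (t2 m y) D + \sum_(y <- V) count (t3 m) D =
     \sum_(y <- V) \sum_(d <- D) (t1 (mask m J) y d + t2 m y d + t3 m d))%N.
    rewrite -!big_split /=; apply: eq_bigr => y _; rewrite !big_split /=.
    by rewrite !countE.
  under [X in (_ <= X)%N]eq_bigr => m _ do rewrite E.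
  rewrite exchange_big /=; apply: leq_sum => y _.
  rewrite exchange_big /= -sum1_count big_mkcond /= big_seq [X in (_ <= X)%N]big_seq.
  apply: leq_sum => d dD; case: ifP => // ydV.
  pose lt p := light V p (vp p d) y.
  have sm : size (map lt J) == r by rewrite size_map.
  (* I is the set of the primes whose level is light at y *)
  pose m : r.-tuple bool := Tuple sm.
  have lm : all_light V (mask m J) y (vals (mask m J) d).
    rewrite all_light_vals -filter_mask; apply/allP => p.
    by rewrite mem_filter => /andP[].
  have lm' : all_light V (mask (map negb m) J) (y + d) (vals (mask (map negb m) J) d).
    rewrite all_light_vals -map_comp -filter_mask; apply/allP => p.
    rewrite mem_filter /= => /andP[nl pJ].
    have d0 : d != 0 by apply: contraNneq D0 => <-.
    by have := light_endpoint V y (allP Jp p pJ) d0; rewrite -/(lt p) (negPf nl).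
  rewrite (bigD1 m) //= -/(mask _ _) /t1 /t2 /t3 /t1 lm lm' ydV /=.
  apply: leq_trans (leq_addr _ _); rewrite !ltnNge; do 2!case: (_ <= W)%N => //.
apply: (@leq_trans (\sum_(m : r.-tuple bool) 3 * (size V * (L ^ k * W)))); last first.
  rewrite sum_nat_const card_tuple card_bool expnMn.
  have : (2 ^ r <= 2 ^ k)%N by rewrite leq_exp2l.
  move: (2 ^ r)%N (2 ^ k)%N (L ^ k)%N => a b c ab.
  rewrite (_ : 3 * (b * c) * size V * W = b * (3 * (size V * (c * W))))%N; last by ring.
  by rewrite leq_mul2r ab orbT.
apply: leq_trans (leq_mul (leqnn K) split_edges) _.
clearbody W.
rewrite big_distrr /=; apply: leq_sum => m _; rewrite !mulnDr.
have -> : (3 * (size V * (L ^ k * W)) = size V * (L ^ k * W) + size V * (L ^ k * W)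
   + size V * (L ^ k * W))%N by ring.
rewrite !leq_add ?bound1 ?bound3 ?mask_r ?size_map ?size_tuple //.
Qed.

(** * The energy of a set with few coprime parts *)

Definition smooth_part (J : seq nat) (a : rat) : rat := \prod_(p <- J) p%:R ^ vp p a.

Definition coprime_part J a := a / smooth_part J a.

Definition coprime_parts J A := undup [seq coprime_part J a | a <- A].

Lemma natr_prime_neq0 p : prime p -> p%:R != 0 :> rat.
Proof. by move/prime_gt0; rewrite pnatr_eq0 lt0n. Qed.

Lemma smooth_part_gt0 J a : all prime J -> 0 < smooth_part J a.
Proof.
move=> /allP Jp; rewrite /smooth_part big_seq; elim/big_ind: _ => //; first exact: mulr_gt0.
by move=> p /Jp/prime_gt0 p0; rewrite exprz_gt0 // ltr0n.
Qed.

Lemma smooth_part_neq0 J a : all prime J -> smooth_part J a != 0.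
Proof. by move=> Jp; rewrite gt_eqF // smooth_part_gt0. Qed.

Lemma eq_smooth_part J a a' : vals J a = vals J a' -> smooth_part J a = smooth_part J a'.
Proof.
by move/eqP/eq_valsP => h; apply: eq_big_seq => p pJ; rewrite h.
Qed.

Lemma vp_smooth_part J a q : all prime J -> uniq J -> prime q ->
  vp q (smooth_part J a) = if q \in J then vp q a else 0.
Proof.
move=> + + pq; elim: J => [|p J IH] /=; first by rewrite /smooth_part big_nil vp1.
move=> /andP[pp Jp] /andP[pJ uJ].
rewrite /smooth_part big_cons vpM // ?expfz_neq0 ?natr_prime_neq0 ?smooth_part_neq0 //.
rewrite -/(smooth_part J a) IH // vpXz ?natr_prime_neq0 // vp_prime // inE.
have [->|] := eqVneq q p; first by rewrite (negPf pJ) mulr1 addr0.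
by rewrite mulr0 add0r.
Qed.

Lemma vp_coprime_part J a q : all prime J -> uniq J -> prime q -> a != 0 ->
  vp q (coprime_part J a) = if q \in J then 0 else vp q a.
Proof.
move=> Jp uJ pq a0; rewrite vpM ?invr_eq0 ?smooth_part_neq0 // vpV ?smooth_part_neq0 //.
by rewrite vp_smooth_part //; case: ifP; rewrite ?subrr ?subr0.
Qed.

Lemma smooth_coprime_part J a : all prime J -> smooth_part J a * coprime_part J a = a.
Proof. by move=> Jp; rewrite mulrC divfK ?smooth_part_neq0. Qed.

(** The diagonal [a = a'] contributes [|Y| |A|].  If [a] and [a'] have the same
    valuations at [J] but different coprime parts [b] and [b'], then
    [a - a' = s (b - b')]; for fixed [b] and [b'] the numbers [s (b - b')] have
    distinct valuation vectors, and [edge_count] applies to them. *)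
Lemma energy_upper (A Y : seq rat) J k L K :
  uniq A -> 0 \notin A -> all prime J -> uniq J ->
  (size J <= k)%N -> (0 < L)%N -> (0 < K)%N -> uniq Y -> (size Y <= 2 ^ L)%N ->
  (K * energy J A Y <= size Y * (K * size A +
     3 * (2 * L) ^ k * (size A * size (coprime_parts J A) +
                        K ^ 3 * size (coprime_parts J A) ^ 2)))%N.
Proof.
move=> uA A0 Jp uJ Jk L0 K0 uY sY; set B := coprime_parts J A.
set c := (3 * _ ^ k)%N.
pose ok b' a := (b' != coprime_part J a) && (smooth_part J a * b' \in A).
pose D b b' := [seq smooth_part J a * (b - b') | a <- A & (coprime_part J a == b) && ok b' a].
have edges b b' : (K * \sum_(y <- Y) count (fun d => (y + d)%R \in Y) (D b b') <=
    c * size Y * (size (D b b') + K ^ 3))%N.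
  have inD a : a \in [seq a <- A | (coprime_part J a == b) && ok b' a] ->
      [/\ a \in A, a != 0, b - b' != 0 & a = smooth_part J a * b].
    rewrite mem_filter => /andP[/andP[/eqP cb /andP[nb _]] aA]; split=> //.
    - by apply: contraNneq A0 => <-.
    - by rewrite subr_eq0 eq_sym -cb.
    - by rewrite -cb smooth_coprime_part.
  have key a a' : a \in [seq a <- A | (coprime_part J a == b) && ok b' a] ->
      a' \in [seq a <- A | (coprime_part J a == b) && ok b' a] ->
      vals J (smooth_part J a * (b - b')) = vals J (smooth_part J a' * (b - b')) -> a = a'.
    move=> /inD[aA a0 bb0 ea] /inD[a'A a'0 _ ea'] /eqP/eq_valsP h.
    suff e : vals J a = vals J a' by rewrite ea ea' (eq_smooth_part e).
    apply/eqP/eq_valsP => p pJ; have pp := allP Jp p pJ.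
    move: (h p pJ); rewrite !vpM ?smooth_part_neq0 // !vp_smooth_part // pJ; lia.
  apply: (@edge_count (D b b') Y J k L K) => //.
  - rewrite map_inj_in_uniq ?filter_uniq // => a a' ha ha' e; apply: key => //.
    by rewrite e.
  - apply/mapP => -[a /inD[_ _ bb0 _]] /eqP; rewrite eq_sym mulf_eq0 (negPf bb0) orbF.
    by apply/negP; rewrite smooth_part_neq0.
  - by move=> d d' /mapP[a ha ->] /mapP[a' ha' ->] e; rewrite (key a a' ha ha' e).
(* a' is recovered from its coprime part, as it shares the smooth part of a *)
have step y a : y \in Y -> a \in A ->
    (count (fun a' => (vals J a' == vals J a) && ((y + a - a')%R \in Y)) A <=
     1 + count (fun b' => ok b' a && ((y + smooth_part J a * (coprime_part J a - b'))%R \in Y)) B)%N.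
  move=> yY aA.
  have e2 : count (pred1 a) A = 1%N by rewrite count_uniq_mem // aA.
  rewrite -[in X in (_ <= X)%N]e2.
  pose P a' := [&& a' != a, vals J a' == vals J a & y + a - a' \in Y].
  apply: (@leq_trans (count (pred1 a) A + count P A)).
    rewrite -count_predUI; apply: leq_trans (leq_addr _ _); apply: sub_count => a' /=.
    by rewrite /P; case: (a' == a).
  rewrite leq_add2l -size_filter -(size_map (coprime_part J)) -size_filter.
  have inP a' : a' \in [seq a' <- A | P a'] -> a' = smooth_part J a * coprime_part J a'.
    rewrite mem_filter => /andP[/and3P[_ /eqP/eq_smooth_part <- _] _].
    by rewrite smooth_coprime_part.
  apply: uniq_leq_size.
    rewrite map_inj_in_uniq ?filter_uniq // => a1 a2 /inP h1 /inP h2 e.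
    by rewrite h1 h2 e.
  move=> b' /mapP[a' ha' ->]; have ea' := inP _ ha'.
  move: ha'; rewrite !mem_filter => /andP[/and3P[na' /eqP sa' ya'] a'A].
  rewrite /ok mem_undup map_f // andbT -ea' a'A mulrBr -ea' smooth_coprime_part // addrA ya'.
  rewrite !andbT; apply: contraNneq na' => e.
  by rewrite ea' e smooth_coprime_part.
have tot : (energy J A Y <= size Y * size A +
    \sum_(b <- B) \sum_(b' <- B) \sum_(y <- Y) count (fun d => (y + d)%R \in Y) (D b b'))%N.
  apply: (@leq_trans (\sum_(y <- Y) \sum_(a <- A)
     (1 + count (fun b' => ok b' a && ((y + smooth_part J a * (coprime_part J a - b'))%R \in Y)) B)%N)).
    rewrite /energy big_seq [X in (_ <= X)%N]big_seq; apply: leq_sum => y yY.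
    by rewrite big_seq [X in (_ <= X)%N]big_seq; apply: leq_sum => a; apply: step.
  rewrite (_ : (size Y * size A = \sum_(y <- Y) \sum_(a <- A) 1)%N); last first.
    rewrite -sum1_size big_distrl /=; apply: eq_bigr => y _; by rewrite mul1n sum1_size.
  under eq_bigr => y _ do rewrite big_split /=.
  rewrite big_split /= leq_add2l eq_leq //.
  under eq_bigr => y _ do rewrite (sum_fibers (coprime_part J)) -/(coprime_parts J A) -/B.
  rewrite exchange_big /=; apply: eq_bigr => b _.
  rewrite [RHS]exchange_big /=; apply: eq_bigr => y _.
  rewrite -big_filter sum_count_exchange; apply: eq_bigr => b' _.
  rewrite /D count_map count_filter count_filter; apply: eq_count => a /=.
  case: (eqVneq (coprime_part J a) b) => [->|_]; last by rewrite !andbF.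
  by rewrite andbT /= andbC.
have sizeD : (\sum_(b <- B) \sum_(b' <- B) (size (D b b') + K ^ 3) <=
    size A * size B + K ^ 3 * size B ^ 2)%N.
  have const (T : Type) (r : seq T) (n : nat) : (\sum_(i <- r) n = n * size r)%N.
    by rewrite -sum1_size big_distrr /=; apply: eq_bigr => i _; rewrite muln1.
  apply: (@leq_trans (\sum_(b <- B) \sum_(b' <- B) (count (fun a => coprime_part J a == b) A + K ^ 3))%N).
    apply: leq_sum => b _; apply: leq_sum => b' _; rewrite leq_add2r size_map size_filter.
    by apply: sub_count => a /andP[].
  under eq_bigr => b _ do rewrite const.
  rewrite -big_distrl big_split /= const mulnDl -mulnn !mulnA leq_add2r leq_mul2r.
  by rewrite -count_fibers ?undup_uniq // count_size orbT.
apply: leq_trans (leq_mul (leqnn K) tot) _.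
rewrite mulnDr [X in (_ <= X)%N]mulnDr; apply: leq_add; first by rewrite mulnCA.
rewrite [X in (_ <= X)%N]mulnCA [X in (_ <= X)%N]mulnA.
apply: leq_trans (leq_mul (leqnn (c * size Y)) sizeD).
rewrite !big_distrr /=; apply: leq_sum => b _; rewrite !big_distrr /=.
by apply: leq_sum => b' _; rewrite edges.
Qed.

(** * Finding the primes J; products *)

(** Impose properties one by one, as long as some new property holds for a
    proportion greater than [1 / c.+1] of what is left.  No element has more than
    [k] of the properties, so this stops after at most [k] steps. *)
Lemma maximal_chain (S T : eqType) (holds : S -> pred T) (A : seq T) k c :
  (0 < size A)%N ->
  (forall a ts, a \in A -> uniq ts -> all (holds^~ a) ts -> (size ts <= k)%N) ->
  exists ts, let A' := [seq a <- A | all (holds^~ a) ts] in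
    [/\ uniq ts, (0 < size A')%N, (size A <= c.+1 ^ k * size A')%N &
        forall t, t \notin ts -> (c.+1 * count (holds t) A' <= size A')%N].
Proof.
move=> A0 Ak; pose sub ts := [seq a <- A | all (holds^~ a) ts].
suff main m ts : (k - size ts <= m)%N -> uniq ts -> (0 < size (sub ts))%N ->
    (size A <= c.+1 ^ size ts * size (sub ts))%N ->
    exists ts, [/\ uniq ts, (0 < size (sub ts))%N, (size A <= c.+1 ^ k * size (sub ts))%N &
        forall t, t \notin ts -> (c.+1 * count (holds t) (sub ts) <= size (sub ts))%N].
  have sub0 : sub [::] = A by rewrite /sub /= filter_predT.
  by apply: (main k [::]); rewrite ?sub0 ?expn0 ?mul1n ?subn0.
have sub_size us : uniq us -> (0 < size (sub us))%N -> (size us <= k)%N.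
  rewrite size_filter -has_count => uus /hasP[a aA aus].
  exact: Ak aA uus aus.
elim: m ts => [|m IH] ts km uts pts cts.
all: have [[t [tts big]]|no] := EM (exists t, t \notin ts /\
   (size (sub ts) < c.+1 * count (holds t) (sub ts))%N); last first.
1,3: exists ts; split=> //.
1,3: by apply: leq_trans cts _; rewrite leq_mul2r leq_pexp2l ?orbT // sub_size.
1,2: by move=> t tts; rewrite leqNgt; apply/negP => big; apply: no; exists t.
all: have sub_cons : count (holds t) (sub ts) = size (sub (t :: ts))
  by rewrite !size_filter count_filter.
all: have pts' : (0 < size (sub (t :: ts)))%N by rewrite -sub_cons; case: count big => //; rewrite muln0.
all: have uts' : uniq (t :: ts) by rewrite /= tts.
  by have /= := sub_size _ uts' pts'; lia.
apply: (IH (t :: ts)) => //=; first by have /= := sub_size _ uts' pts'; lia.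
apply: leq_trans cts _; rewrite expnS -mulnA mulnCA leq_mul2l.
by rewrite -sub_cons (ltnW big) orbT.
Qed.

(** Two applications of [maximal_chain].  The first one imposes values
    [v_p a = m] with [m <> 0] until no such condition is popular; its primes
    form [P].  The second one imposes that primes divide the elements, until no
    further prime divides many of them; [J] consists of these primes, without
    [P].  The second step shrinks the set by at most [(2 k) ^ k], which the
    factor [(2 k) ^ k] in the first threshold compensates: the slices remain
    thin. *)
Lemma structured_subset (A : seq rat) k L :
  (0 < size A)%N -> uniq A -> 0 \notin A -> (0 < k)%N -> (0 < L)%N ->
  (forall a, a \in A -> (size (supp a) <= k)%N) ->
  exists (A' : seq rat) (J P : seq nat), [/\ {subset A' <= A}, uniq A' & (0 < size A')%N] /\
    [/\ all prime J, uniq J & (size J <= k)%N] /\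
    [/\ thin_slices A' J k L,
        (forall p, p \in P -> {in A' &, forall a a', vp p a = vp p a'}),
        (forall q, prime q -> q \notin J -> q \notin P ->
           (2 * k * count (fun a => vp q a != 0) A' <= size A')%N) &
        (size A <= (2 * k * L * (2 * k) ^ k) ^ k * (2 * k) ^ k * size A')%N].
Proof.
move=> sA uA A0 k0 L0 hk.
have nz a : a \in A -> a != 0 by move=> aA; apply: contraNneq A0 => <-.
pose h1 (t : nat * int) a := [&& prime t.1, t.2 != 0 & vp t.1 a == t.2].
set c1 := (2 * k * L * (2 * k) ^ k)%N.
have c1p : (0 < c1)%N by rewrite !muln_gt0 expn_gt0 muln_gt0 k0 L0.
have [|ts] := @maximal_chain _ _ h1 A k c1.-1 sA.
  move=> a ts aA uts /allP hts; rewrite -(size_map fst); apply: leq_trans (hk a aA).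
  apply: uniq_leq_size.
    rewrite map_inj_in_uniq // => -[p m] [p' m'] /hts/and3P[/= _ _ /eqP <-] /hts.
    by move=> /and3P[/= _ _ /eqP <-] ->.
  move=> p /mapP[[q m] /hts/and3P[/= pq m0 /eqP vq]] ->.
  by rewrite mem_supp ?nz // pq vq.
rewrite prednK //; set A1 := seq.filter _ A => -[uts sA1 le1 max1].
have A1A : {subset A1 <= A} by move=> a; rewrite mem_filter => /andP[].
have c2p : (0 < 2 * k)%N by rewrite muln_gt0.
have [|ps] := @maximal_chain _ _ (fun p a => p \in supp a) A1 k (2 * k).-1 sA1.
  move=> a ps /A1A aA ups /allP hps; apply: leq_trans (hk a aA).
  exact: uniq_leq_size.
rewrite prednK //; set A2 := seq.filter _ A1 => -[ups sA2 le2 max2].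
have A21 : {subset A2 <= A1} by move=> a; rewrite mem_filter => /andP[].
have A2ps a p : a \in A2 -> p \in ps -> p \in supp a.
  by rewrite mem_filter => /andP[/allP h _] /h.
have [a0 a0A2] : exists a, a \in A2 by case: A2 sA2 {A21 A2ps max2 le2} => // a s; exists a; rewrite mem_head.
have nz2 a : a \in A2 -> a != 0 by move=> /A21/A1A/nz.
have ps_prime p : p \in ps -> prime p.
  by move=> /(A2ps a0 p a0A2); rewrite mem_supp ?nz2 // => /andP[].
pose P := map fst ts.
exists A2, [seq p <- ps | p \notin P], P; split; first split=> //.
- by move=> a /A21/A1A.
- by rewrite !filter_uniq.
split; first split.
- apply/allP => p; rewrite mem_filter => /andP[_ pps].
  exact: ps_prime.
- by rewrite filter_uniq.
- apply: leq_trans (_ : size ps <= _)%N; first by rewrite size_filter count_size.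
  apply: leq_trans (hk a0 (A1A _ (A21 _ a0A2))); apply: uniq_leq_size => // p.
  exact: A2ps.
split.
- move=> p m; rewrite mem_filter => /andP[pP pps].
  have [m0|m0] := eqVneq m 0.
    rewrite (_ : count _ _ = 0)%N ?muln0 //; apply/eqP.
    rewrite -leqn0 leqNgt -has_count; apply/hasPn => a aA2.
    by have := A2ps a p aA2 pps; rewrite mem_supp ?nz2 // m0 => /andP[].
  have pp := ps_prime p pps.
  have pmts : (p, m) \notin ts by apply: contraNN pP => pt; apply/mapP; exists (p, m).
  have := leq_trans (max1 _ pmts) le2.
  rewrite (@eq_count _ (h1 (p, m)) (fun a => vp p a == m)); last first.
    by move=> a; rewrite /h1 /= pp m0.
  rewrite /c1 [(2 * k * L * _)%N]mulnC -mulnA leq_pmul2l ?expn_gt0 ?c2p //.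
  apply: leq_trans; rewrite leq_mul2l; apply/orP; right.
  by rewrite count_filter; apply: sub_count => a /andP[].
- move=> p /mapP[[q m] qmts ->] a a' /A21 + /A21.
  rewrite !mem_filter => /andP[/allP/(_ _ qmts)/and3P[_ _ /eqP /= ->] _].
  by move=> /andP[/allP/(_ _ qmts)/and3P[_ _ /eqP /= ->] _].
- move=> q pq; rewrite mem_filter negb_and negbK => /orP[->//|qps] _.
  have := max2 q qps; rewrite (@eq_in_count _ (fun a => q \in supp a) (fun a => vp q a != 0)) //.
  by move=> a /A21/A1A/nz a0'; rewrite mem_supp // pq.
- rewrite -mulnA; apply: leq_trans le1 _; by rewrite leq_mul2l le2 orbT.
Qed.

Lemma supp_mul_sub x y : x != 0 -> y != 0 -> {subset supp (x * y) <= supp x ++ supp y}.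
Proof.
move=> x0 y0 p; rewrite (mem_cat p (supp x)) !mem_supp ?mulf_neq0 // => /andP[pp].
rewrite pp /= vpM //; lia.
Qed.

(** Choose one representative [r] in [A] for each coprime part.  For at least
    half of the [a] in [A], no prime outside [J] and [P] occurs both in [a] and
    in [r].  For such pairs, [x = a r] together with the set of primes of [x]
    that occur in [r] determines all valuations of the coprime part of [r]:
    those at [J] vanish, those at [P] are constant on [A], and the other ones
    are those of [x] or [0].  With the sign of [r], this makes at most
    [2 * 2 ^ (2 k)] pairs for each [x]. *)
Lemma products_lower (A AA : seq rat) (J P : seq nat) k :
  uniq A -> 0 \notin A -> all prime J -> uniq J -> (0 < k)%N ->
  (forall a, a \in A -> (size (supp a) <= k)%N) ->
  (forall p, p \in P -> {in A &, forall a a', vp p a = vp p a'}) ->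
  (forall q, prime q -> q \notin J -> q \notin P ->
     (2 * k * count (fun a => vp q a != 0) A <= size A)%N) ->
  (forall a a', a \in A -> a' \in A -> a * a' \in AA) ->
  (size A * size (coprime_parts J A) <= 4 * 4 ^ k * size AA)%N.
Proof.
move=> uA A0 Jp uJ k0 hk const sparse hAA.
have nz a : a \in A -> a != 0 by move=> aA; apply: contraNneq A0 => <-.
pose rep b := nth 0 A (find (fun a => coprime_part J a == b) A).
have repP b : b \in coprime_parts J A -> rep b \in A /\ coprime_part J (rep b) = b.
  rewrite mem_undup => /mapP[a aA ->].
  have h : has (fun a' => coprime_part J a' == coprime_part J a) A by apply/hasP; exists a.
  by split; [rewrite mem_nth -?has_find | exact/eqP/(nth_find 0 h)].
pose good r a := all (fun q => (q \in J) || (q \in P) || (vp q a == 0)) (supp r).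
have half r : r \in A -> (size A <= 2 * count (good r) A)%N.
  move=> rA.
  pose Q (q : nat) a := [&& q \notin J, q \notin P & vp q a != 0].
  have := @count_has_le _ _ Q (supp r) A (2 * k) (size A) _.
  have -> : count (fun a => has (Q^~ a) (supp r)) A = (size A - count (good r) A)%N.
    rewrite -(count_predC (good r)) addKn; apply: eq_count => a /=.
    by rewrite -has_predC; apply: eq_has => q; rewrite /Q /= !negb_or andbA.
  move=> /(_ _)/leq_trans => h.
  have {}h : (2 * k * (size A - count (good r) A) <= k * size A)%N.
    apply: h; last by rewrite leq_mul2r hk ?orbT.
    move=> q; rewrite mem_supp ?nz // => /andP[pq _].
    have [qJ|qJ] := boolP (q \in J).
      by rewrite (@eq_count _ (Q q) pred0) ?count_pred0 ?muln0 // => a; rewrite /Q qJ.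
    have [qP|qP] := boolP (q \in P).
      by rewrite (@eq_count _ (Q q) pred0) ?count_pred0 ?muln0 // => a; rewrite /Q qP andbF.
    by apply: leq_trans (sparse q pq qJ qP); rewrite leq_mul2l sub_count ?orbT // => a /and3P[].
  move: h; rewrite [(2 * k)%N]mulnC -mulnA leq_pmul2l //.
  have := count_size (good r) A; lia.
pose prs := [seq (b, a) | b <- coprime_parts J A, a <- [seq a <- A | good (rep b) a]].
have sprs : (size A * size (coprime_parts J A) <= 2 * size prs)%N.
  rewrite size_allpairs_dep sumnE big_map mulnC -sum1_size big_distrl big_distrr /=.
  rewrite big_seq [X in (_ <= X)%N]big_seq; apply: leq_sum => b /repP[rA _].
  by rewrite mul1n size_filter half.
have prsP u : u \in prs -> [/\ u.1 \in coprime_parts J A, u.2 \in A & good (rep u.1) u.2].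
  move=> /allpairsPdep[b [a [bB]]]; rewrite mem_filter => /andP[ga aA] ->.
  by split.
have uprs : uniq prs.
  apply: allpairs_uniq_dep; rewrite ?undup_uniq //.
    by move=> b _; rewrite filter_uniq.
  by move=> [b a] [b' a'] _ _ [-> ->].
(* the bits tell which primes of the product come from the representative;
   the list of these primes is padded up to length 2 k *)
pose code (u : rat * rat) :=
  let r := rep u.1 in let x := u.2 * r in
  (x, [ffun i : 'I_(2 * k) => nth 0%N (supp x) i \in supp r], 0 < r).
pose codes := [seq (v, s) | v <- [seq (x, f) | x <- AA, f <- enum {ffun 'I_(2 * k) -> bool}], s <- [:: true; false]].
suff : (size prs <= size codes)%N.
  rewrite !size_allpairs -cardE card_ffun card_bool card_ord /= expnM.
  move=> h; apply: leq_trans sprs _.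
  rewrite (_ : 4 * 4 ^ k * size AA = 2 * (size AA * (2 ^ 2) ^ k * 2))%N; last by ring.
  by rewrite leq_mul2l h.
rewrite -(size_map code); apply: uniq_leq_size; last first.
  move=> v /mapP[u /prsP[uB uA' _] ->]; apply/allpairsP.
  exists (u.2 * rep u.1, [ffun i : 'I_(2 * k) => nth 0%N (supp (u.2 * rep u.1)) i \in supp (rep u.1)], 0 < rep u.1).
  split=> //=; last by case: ltP.
  by apply: allpairs_f; rewrite ?mem_enum // hAA //; have [] := repP _ uB.
rewrite map_inj_in_uniq // => -[b a] [b' a'] /prsP[/= bB aA ga] /prsP[/= b'B a'A ga'].
rewrite /code /= => -[ex eb es].
have [rA rb] := repP _ bB; have [r'A rb'] := repP _ b'B.
set r := rep b in ex eb es ga rA rb; set r' := rep b' in ex eb es ga' r'A rb'.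
have half_eq (a1 a2 r1 r2 : rat) : a1 \in A -> a2 \in A -> r1 \in A -> r2 \in A ->
    good r1 a1 -> good r2 a2 -> a1 * r1 = a2 * r2 ->
    [ffun i : 'I_(2 * k) => nth 0%N (supp (a1 * r1)) i \in supp r1] =
    [ffun i : 'I_(2 * k) => nth 0%N (supp (a2 * r2)) i \in supp r2] ->
    forall q, prime q -> q \notin J -> q \notin P -> vp q r1 != 0 -> vp q r1 = vp q r2.
  move=> a1A a2A r1A r2A /allP g1 /allP g2 e12 ebits q pq qJ qP v1.
  have q1 : q \in supp r1 by rewrite mem_supp ?nz // pq.
  have va1 : vp q a1 = 0.
    by have := g1 q q1; rewrite (negPf qJ) (negPf qP) => /eqP.
  have vx : vp q (a1 * r1) = vp q r1 by rewrite vpM ?nz // va1 add0r.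
  have qx : q \in supp (a1 * r1) by rewrite mem_supp ?mulf_neq0 ?nz // pq vx.
  have sx : (size (supp (a1 * r1)) <= 2 * k)%N.
    apply: leq_trans (uniq_leq_size (supp_uniq _) (supp_mul_sub (nz _ a1A) (nz _ r1A))) _.
    by rewrite size_cat mul2n -addnn leq_add ?hk.
  have ik : (index q (supp (a1 * r1)) < 2 * k)%N by apply: leq_trans sx; rewrite index_mem.
  move/ffunP: ebits => /(_ (Ordinal ik)); rewrite !ffunE /= -e12 nth_index // q1 => /esym q2.
  have va2 : vp q a2 = 0.
    by have := g2 q q2; rewrite (negPf qJ) (negPf qP) => /eqP.
  by rewrite -vx e12 vpM ?nz // va2 add0r.
have ebb : b = b'.
  rewrite -rb -rb'; have [r0 r'0] := (nz _ rA, nz _ r'A).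
  have pos (z : rat) : (0 < coprime_part J z) = (0 < z).
    by rewrite /coprime_part pmulr_lgt0 // invr_gt0 smooth_part_gt0.
  apply: vp_inj; rewrite ?mulf_neq0 ?invr_eq0 ?smooth_part_neq0 ?pos //.
  move=> q pq; rewrite !vp_coprime_part //; case: ifP => // /negbT qJ.
  have [qP|qP] := boolP (q \in P); first exact: const.
  have [v1|v1] := eqVneq (vp q r) 0; last by apply: (half_eq a a' r r') => //.
  have [v2|v2] := eqVneq (vp q r') 0; first by rewrite v1 v2.
  by apply/esym; apply: (half_eq a' a r' r) => //.
rewrite ebb; congr pair.
move: ex; rewrite /r /r' ebb => /mulIf -> //.
by apply: nz; have [] := repP _ b'B.
Qed.

(** * Combining the estimates *)

(** The smooth part is the same throughout such a class, hence the coprime part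
    tells its elements apart. *)
Lemma vals_class_le A J u : uniq A -> all prime J ->
  (count (fun a => vals J a == u) A <= size (coprime_parts J A))%N.
Proof.
move=> uA Jp; rewrite -size_filter -(size_map (coprime_part J)); apply: uniq_leq_size.
  rewrite map_inj_in_uniq ?filter_uniq // => a a'; rewrite !mem_filter.
  move=> /andP[/eqP sa _] /andP[/eqP sa' _] e.
  have es : smooth_part J a = smooth_part J a' by apply: eq_smooth_part; rewrite sa sa'.
  by rewrite -(smooth_coprime_part a Jp) -(smooth_coprime_part a' Jp) es e.
by move=> b /mapP[a]; rewrite mem_filter => /andP[_ aA] ->; rewrite mem_undup map_f.
Qed.

Lemma sum_product_counts (A S Y X : seq rat) k L :
  (0 < size A)%N -> uniq A -> 0 \notin A -> (0 < k)%N -> (0 < L)%N ->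
  (forall a, a \in A -> (size (supp a) <= k)%N) ->
  uniq Y -> uniq X ->
  (forall a a', a \in A -> a' \in A -> a + a' \in S) ->
  (forall a a', a \in A -> a' \in A -> a * a' \in Y) ->
  (forall a y, a \in A -> y \in Y -> a + y \in X) ->
  (size A + size S <= 2 ^ L)%N -> (size Y + size X <= 2 ^ L)%N ->
  exists N B : nat,
    [/\ (0 < N)%N, (0 < B)%N,
        (size A <= (2 * k * L * (2 * k) ^ k) ^ k * (2 * k) ^ k * N)%N &
        (N * B <= 4 * 4 ^ k * size Y)%N] /\
    [/\ (size Y * N <= 2 * L ^ k * B * size X)%N,
        (N * N <= 2 * L ^ k * B * size S)%N &
        forall K, (0 < K)%N ->
          (K * (size Y * N) ^ 2 <= 4 * size X * L ^ k *
             (size Y * (K * N + 3 * (2 * L) ^ k * (N * B + K ^ 3 * B ^ 2))))%N].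
Proof.
move=> sA uA A0 k0 L0 hk uY uX hS hY hX sAS sYX.
have [A' [J [P [[A'A uA' sA'] [[Jp uJ Jk] [slice const sparse le]]]]]] :=
  structured_subset sA uA A0 k0 L0 hk.
have A'0 : 0 \notin A' by apply: contraNN A0 => /A'A.
exists (size A'), (size (coprime_parts J A')).
have sizeA' : (size A' <= size A)%N by apply: uniq_leq_size.
have subL (T : eqType) (s t : seq T) : {subset s <= s ++ t}.
  by move=> z zs; rewrite mem_cat zs.
have subR (T : eqType) (s t : seq T) : {subset t <= s ++ t}.
  by move=> z zs; rewrite mem_cat zs orbT.
have cls u := vals_class_le u uA' Jp.
split; split=> //.
- case E : A' sA' => [//|a s] _; rewrite -E.
  have : coprime_part J a \in coprime_parts J A' by rewrite mem_undup map_f // E mem_head.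
  by case: (coprime_parts J A').
- apply: (products_lower uA' A'0 Jp uJ k0 _ const sparse) => [a /A'A/hk//|].
  by move=> a a' /A'A aA /A'A a'A; apply: hY.
- apply: (growth k0 L0 Jk Jp slice A'0 uY (subL _ Y X) (subR _ Y X)) => //.
    by rewrite size_cat.
  by move=> y a yY /A'A aA; rewrite addrC hX.
- apply: (growth k0 L0 Jk Jp slice A'0 uA' (subL _ A' S) (subR _ A' S)) => //.
    by rewrite size_cat; apply: leq_trans sAS; rewrite leq_add2r.
  by move=> y a /A'A yA /A'A aA; apply: hS.
- move=> K K0.
  have sY : (size Y <= 2 ^ L)%N by apply: leq_trans sYX; rewrite leq_addr.
  have up := energy_upper uA' A'0 Jp uJ Jk L0 K0 uY sY.
  apply: leq_trans (leq_mul (leqnn (4 * size X * L ^ k)%N) up).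
  rewrite mulnCA leq_mul2l; apply/orP; right.
  apply: (energy_lower k0 L0 Jk Jp slice A'0 uY uX (subL _ Y X) (subR _ Y X)) => //.
    by rewrite size_cat.
  by move=> y a yY /A'A aA; rewrite addrC hX.
Qed.

Lemma first_bound (R : realFieldType) (G q l n N B y x : R) :
  0 <= n -> 0 < N -> 0 < B -> 0 < q -> 0 < l ->
  n <= G * N -> N * B <= q * y -> y * N <= l * B * x ->
  N ^+ 2 <= q * l * x /\ n ^+ 2 <= G ^+ 2 * q * l * x.
Proof.
move=> n0 N0 B0 q0 l0 nN NB yN.
have h : N ^+ 2 <= q * l * x.
  rewrite -(ler_pM2r B0).
  have a1 := ler_wpM2l (ltW N0) NB; have a2 := ler_wpM2l (ltW q0) yN.
  lra.
split=> //; apply: le_trans (_ : (G * N) ^+ 2 <= _).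
  by rewrite ler_pXn2r // nnegrE // (le_trans n0).
by rewrite exprMn; have := ler_wpM2l (sqr_ge0 G) h; lra.
Qed.

(** With [z = 2 q l c x / N ^ 2], the energy inequality divided by [y] and
    combined with [N B <= q y] reads [K N B <= z (K N + N B + K ^ 3 B ^ 2)].
    Choosing the integer [K] between [2 z] and [3 z] absorbs the term [N B]
    into the left-hand side, and leaves [N B / 2 <= z N + 9 z ^ 3 B ^ 2], so
    that [B <= 4 z] or [N <= 36 z ^ 3 B]. *)
Lemma second_bound (R : archiRealFieldType) (G q l c n N B y x s M : R) :
  0 <= n -> 0 < N -> 0 < B -> 1 <= q -> 1 <= l -> 1 <= c -> 0 < y -> 0 <= x ->
  0 <= s ->
  n <= G * N -> N * B <= q * y -> y * N <= l * B * x -> N * N <= l * B * s ->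
  (forall K : nat, (0 < K)%N ->
     K%:R * (y * N) ^+ 2 <=
       2 * x * l * (y * (K%:R * N + c * (N * B + K%:R ^+ 3 * B ^+ 2)))) ->
  x <= M * n ^+ 2 ->
  n ^+ 2 <= 320 * q ^+ 4 * l ^+ 4 * c ^+ 3 * G ^+ 8 * M ^+ 3 * Num.max y s.
Proof.
move=> n0 N0 B0 q1 l1 c1 y0 x0 s0 nN NB yN NN energy xM.
have q0 : 0 < q by lra.
have l0 : 0 < l by lra.
have c0 : 0 < c by lra.
have [Nx nG] := first_bound n0 N0 B0 q0 l0 nN NB yN.
pose z := 2 * q * l * c * x / N ^+ 2.
have N2 : 0 < N ^+ 2 by rewrite exprn_gt0.
have zN : z * N ^+ 2 = 2 * q * l * c * x by rewrite /z divfK ?gt_eqF.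
have z1 : 1 <= z.
  rewrite -(ler_pM2r N2) zN mul1r; apply: (le_trans Nx).
  have : 0 <= q * l * x by rewrite !mulr_ge0 // ltW.
  by nra.
pose K := (Num.truncn (2 * z)).+1.
have K2 : 2 * z <= K%:R by rewrite ltW // truncnS_gt.
have K3 : K%:R <= 3 * z.
  have : (Num.truncn (2 * z))%:R <= 2 * z by rewrite truncn_le; lra.
  by rewrite /K -natr1; lra.
have K0 : 0 < K%:R :> R by rewrite ltr0n.
set k : R := K%:R in K2 K3 K0.
have NB0 : 0 < N * B by rewrite mulr_gt0.
have B2 : 0 < B ^+ 2 by rewrite exprn_gt0.
pose W := k * N + N * B + k ^+ 3 * B ^+ 2.
have e1 : k * (N * B) <= z * W.
  have e := energy K (ltn0Sn _); rewrite -/k in e.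
  have e' : k * (y * N ^+ 2) <= 2 * x * l * (c * W).
    rewrite -(ler_pM2l y0).
    have : k * N + c * (N * B + k ^+ 3 * B ^+ 2) <= c * W.
      have c10 : 0 <= c - 1 by lra.
      have := mulr_ge0 c10 (mulr_ge0 (ltW K0) (ltW N0)).
      rewrite /W; lra.
    have xl : 0 <= y * (2 * x * l) by rewrite !mulr_ge0 // ltW.
    move/(ler_wpM2l xl); lra.
  rewrite -(ler_pM2r N2).
  have zNW := congr1 ( *%R^~ W) zN.
  have kN : 0 <= k * N ^+ 2 by rewrite mulr_ge0 // ltW.
  have := ler_wpM2l kN NB; have := ler_wpM2l (ltW q0) e'; lra.
have e2 : N * B / 2 <= z * N + 9 * z ^+ 3 * B ^+ 2.
  have f1 : N * B / 2 <= z * N + z * k ^+ 2 * B ^+ 2.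
    rewrite -(ler_pM2l K0).
    have := ler_wpM2r (ltW NB0) K2; move: e1; rewrite /W; lra.
  have f2 : k ^+ 2 <= (3 * z) ^+ 2 by rewrite ler_pXn2r // nnegrE; lra.
  have zB : 0 <= z * B ^+ 2 by rewrite mulr_ge0 ?(ltW B2) //; lra.
  have := ler_wpM2l zB f2; lra.
have m0 : 0 <= Num.max y s by rewrite le_max s0 orbT.
have ym : y <= Num.max y s by rewrite le_max lexx.
have sm : s <= Num.max y s by rewrite le_max lexx orbT.
set m := Num.max y s in m0 ym sm *.
have z3 : z <= z ^+ 3 by rewrite ler_eXnr.
have z3p : 0 <= z ^+ 3 by rewrite exprn_ge0 //; lra.
have key : N ^+ 2 <= 40 * q * l * z ^+ 3 * m.
  have [h|h] : B <= 4 * z \/ N <= 36 * z ^+ 3 * B.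
    have [h|h] := lerP B (4 * z); first by left.
    right; rewrite -(ler_pM2r B0).
    have := ler_wpM2r (ltW N0) (ltW h); lra.
  - have ls : 0 <= l * s by rewrite mulr_ge0 // ltW.
    have g1 := ler_wpM2l ls h.
    have g2 := ler_wpM2l ls z3.
    have lz : 0 <= l * z ^+ 3 by rewrite mulr_ge0 // ltW.
    have g3 := ler_wpM2l lz sm.
    have q10 : 0 <= q - 1 by lra.
    have g4 := mulr_ge0 q10 (mulr_ge0 lz m0).
    have g5 := mulr_ge0 (mulr_ge0 (ltW q0) lz) m0.
    lra.
  - have g1 := ler_wpM2l (ltW N0) h.
    have g2 := ler_wpM2l z3p NB.
    have qz : 0 <= q * z ^+ 3 by rewrite mulr_ge0 // ltW.
    have g3 := ler_wpM2l qz ym.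
    have l10 : 0 <= l - 1 by lra.
    have g4 := mulr_ge0 l10 (mulr_ge0 qz m0).
    have g5 := mulr_ge0 (mulr_ge0 (ltW l0) qz) m0.
    lra.
have G0 : 0 <= G ^+ 2 by rewrite sqr_ge0.
have nGN : n ^+ 2 <= G ^+ 2 * N ^+ 2.
  by rewrite -exprMn ler_pXn2r // nnegrE // (le_trans n0).
have zM : z <= 2 * q * l * c * G ^+ 2 * M.
  rewrite -(ler_pM2r N2) zN.
  have M0 : 0 <= M.
    rewrite leNgt; apply/negP => Mneg.
    have : M * n ^+ 2 <= 0 by rewrite mulr_le0_ge0 ?sqr_ge0 // ltW.
    have : 0 < q * l * x by apply: lt_le_trans Nx.
    have : 0 <= q * l by rewrite mulr_ge0 // ltW.
    move=> ql qlx Mn; have x00 : x <= 0 by apply: le_trans Mn.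
    have := mulr_ge0_le0 ql x00; lra.
  have g := ler_wpM2l M0 nGN.
  have h : 0 <= 2 * q * l * c by rewrite !mulr_ge0 // ltW.
  have := ler_wpM2l h (le_trans xM g); lra.
have zM3 : z ^+ 3 <= (2 * q * l * c * G ^+ 2 * M) ^+ 3.
  by rewrite ler_pXn2r // nnegrE; lra.
apply: le_trans nGN _; apply: le_trans (ler_wpM2l G0 key) _.
have h := mulr_ge0 G0 (mulr_ge0 (mulr_ge0 (ltW q0) (ltW l0)) m0).
have := ler_wpM2l h zM3; lra.
Qed.

(** * Powers of the logarithm as factors |A|^o(1) *)

(** An exponent [L] of order [log n] with [2 ^ L >= 2 n ^ 3]: it bounds the
    number of light levels in any of the sets that occur, all of which have at
    most [2 n ^ 3] elements. *)
Definition dyadic_depth n := (3 * trunc_log 2 n + 4)%N.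

Lemma dyadic_depth_bound n m : (m <= 2 * n ^ 3)%N -> (m <= 2 ^ dyadic_depth n)%N.
Proof.
move=> mn; apply: leq_trans mn _.
have h : (n ^ 3 <= 2 ^ ((trunc_log 2 n).+1 * 3))%N.
  by rewrite expnM leq_exp2r // ltnW // trunc_log_ltn.
rewrite /dyadic_depth (_ : 3 * _ + 4 = ((trunc_log 2 n).+1 * 3).+1)%N; last by lia.
by rewrite [in X in (_ <= X)%N]expnS leq_mul2l h.
Qed.

(** [eps n] is the logarithm of [c * (dyadic_depth n) ^ D] in base [n].  With
    [w ^ 2] the integer part of the binary logarithm of [n], its numerator is
    [O(w)] since [ln x < x], and its denominator is at least [w ^ 2 * ln 2]. *)
Lemma polylog_exponent (R : realType) (c : R) (D : nat) : 1 <= c ->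
  exists eps : nat -> R, [/\ eps @ \oo --> (0 : R), eps 0%N = 0 &
    forall n, (1 < n)%N ->
      n%:R `^ (2 - eps n) = n%:R ^+ 2 / (c * (dyadic_depth n)%:R ^+ D)].
Proof.
move=> c1.
exists (fun n => if (1 < n)%N then ln (c * (dyadic_depth n)%:R ^+ D) / ln n%:R else 0).
have c0 : 0 < c by apply: lt_le_trans c1.
have d1 n : (1 : R) <= (dyadic_depth n)%:R by rewrite ler1n /dyadic_depth; lia.
have arg1 n : 1 <= c * (dyadic_depth n)%:R ^+ D by rewrite mulr_ege1 // exprn_ege1.
have lnn n : (1 < n)%N -> 0 < ln n%:R :> R by move=> n1; rewrite ln_gt0 // ltr1n.
split=> //; last first.
  move=> n n1; rewrite n1.
  have n0 : (0 : R) < n%:R by rewrite ltr0n; lia.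
  rewrite powRB; last by rewrite (gt_eqF n0) implybT.
  rewrite powR_mulrn; last exact: ltW.
  congr (_ / _); rewrite /powR gt_eqF // divfK ?gt_eqF ?lnn //.
  by rewrite lnK // posrE; apply: lt_le_trans (arg1 n).
apply/cvgrPdist_le => e e0.
have ln2 : 0 < ln 2 :> R by rewrite ln_gt0 // ltr1n.
have lnc : 0 <= ln c by rewrite ln_ge0.
pose u := (ln c + 6 * D%:R) / (e * ln 2).
pose m := (Num.truncn (u ^+ 2)).+1.
exists (2 ^ m)%N => // n /= nm; rewrite sub0r normrN.
have n1 : (1 < n)%N by apply: leq_trans nm; rewrite -{1}(expn0 2) ltn_exp2l.
rewrite n1 ger0_norm; last first.
  by rewrite divr_ge0 ?(ln_ge0 (arg1 n)) // ltW ?lnn.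
rewrite ler_pdivrMr ?lnn //.
set t := trunc_log 2 n.
have tm : (m <= t)%N by rewrite trunc_log_max.
have t1 : (1 : R) <= t%:R by rewrite ler1n; apply: leq_trans tm.
have t0 : (0 : R) < t%:R by apply: lt_le_trans t1.
pose w := Num.sqrt (t%:R : R).
have w0 : 0 < w by rewrite sqrtr_gt0.
have ww : w ^+ 2 = t%:R by rewrite sqr_sqrtr // ltW.
have w1 : 1 <= w by rewrite -sqrtr1 ler_wsqrtr.
have lnt : t%:R * ln 2 <= ln n%:R :> R.
  rewrite mulr_natl -lnXn // ler_ln ?posrE ?exprn_gt0 // ?ltr0n; last by lia.
  by rewrite -natrX ler_nat trunc_logP //; lia.
have uw : u <= w.
  apply: le_trans (ler_norm _) _; rewrite -(@ler_pXn2r _ 2) // ?nnegrE ?(ltW w0) //.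
  rewrite real_normK ?num_real // ww; apply: le_trans (ltW (truncnS_gt _)) _.
  by rewrite ler_nat.
have lnd : ln (dyadic_depth n)%:R <= 6 * w.
  have dw : (dyadic_depth n)%:R <= (3 * w) ^+ 2.
    rewrite exprMn ww /dyadic_depth natrD natrM -/t; lra.
  apply: (@le_trans _ _ (ln ((3 * w) ^+ 2))).
    by rewrite ler_ln // ?posrE ?exprn_gt0 ?mulr_gt0 //; apply: lt_le_trans (d1 n).
  have w3 : 0 < 3 * w by rewrite mulr_gt0.
  rewrite lnXn // mulr2n; have := ln_sublinear w3; lra.
have d0 : (0 : R) < (dyadic_depth n)%:R by apply: lt_le_trans (d1 n).
rewrite lnM ?posrE ?exprn_gt0 // lnXn // -[_ *+ D]mulr_natl.
apply: (@le_trans _ _ ((ln c + 6 * D%:R) * w)).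
  have := ler_wpM2l (ler0n R D) lnd; have := ler_wpM2l lnc w1; lra.
have eln : 0 < e * ln 2 by rewrite mulr_gt0.
have -> : ln c + 6 * D%:R = u * (e * ln 2) by rewrite /u divfK ?gt_eqF.
have := ler_wpM2l (ltW e0) lnt; rewrite -ww.
have := ler_wpM2r (mulr_ge0 (ltW eln) (ltW w0)) uw; lra.
Qed.

(** * The sum-product theorem *)

Lemma card_sumset_le A B : (#|` sumset A B| <= #|` A| * #|` B|)%N.
Proof.
rewrite -(size_allpairs +%R); apply: uniq_leq_size; first exact: fset_uniq.
by move=> x /imfset2P[a aA [b bB ->]]; apply: allpairs_f.
Qed.

Lemma card_prodset_le A B : (#|` prodset A B| <= #|` A| * #|` B|)%N.
Proof.
rewrite -(size_allpairs *%R); apply: uniq_leq_size; first exact: fset_uniq.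
by move=> x /imfset2P[a aA [b bB ->]]; apply: allpairs_f.
Qed.

Lemma supp_le (A : {fset rat}) k a :
  few_prime_factors k A -> a \in A -> (size (supp a) <= k)%N.
Proof.
move=> hk aA; rewrite /supp size_cat; apply: hk.
- exact: denq_neq0.
- exact: coprime_num_den.
- by rewrite divq_num_den.
Qed.

Theorem theorem4 (R : realType) :
  exists C : R, 0 <= C /\
  forall k : nat, (1 <= k)%N ->
  exists eps1 eps2 : nat -> R,
    [/\ eps1 @ \oo --> (0 : R), eps2 @ \oo --> (0 : R) &
    forall A : {fset rat}, 0 \notin A -> few_prime_factors k A ->
      #|` A|%:R `^ (2 - eps1 #|` A|) <= #|` sumset A (prodset A A)|%:R
      /\
      forall M : R, 0 < M ->
        #|` sumset A (prodset A A)|%:R <= M * #|` A|%:R ^+ 2 ->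
        exists c : R, 0 <= c <= C /\
          M `^ (- c) * #|` A|%:R `^ (2 - eps2 #|` A|)
            <= Num.max #|` prodset A A|%:R #|` sumset A A|%:R ].
Proof.
exists 3; split=> [|k k1]; first by [].
pose g := ((2 * k * (2 * k) ^ k) ^ k * (2 * k) ^ k)%N.
pose q := (4 * 4 ^ k)%N.
(* the loss of [second_bound] is C * L ^ (15 k): l ^ 4, c ^ 3 and G ^ 8
   contribute L ^ (4 k), L ^ (3 k) and L ^ (8 k) *)
pose C := (320 * q ^ 4 * 2 ^ 4 * (3 * 2 ^ k) ^ 3 * g ^ 8)%N.
have q0 : (0 < q)%N by rewrite muln_gt0 expn_gt0.
have g0 : (0 < g)%N by rewrite muln_gt0 !expn_gt0 !muln_gt0 expn_gt0 !muln_gt0 k1.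
have C1 : (1 : R) <= C%:R.
  have pos (x y z : nat) : (0 < x)%N -> (0 < y)%N -> (0 < z)%N ->
      (1 <= 320 * x ^ 4 * 2 ^ 4 * (3 * z) ^ 3 * y ^ 8)%N.
    by move=> x0 y0 z0; rewrite !(muln_gt0, expn_gt0) x0 y0 z0.
  by rewrite ler1n pos // expn_gt0.
have [eps [eps_cvg eps0 epsE]] := polylog_exponent (15 * k) C1.
exists eps, eps; split=> // A A0 hk.
set Y := prodset A A; set X := sumset A Y; set S := sumset A A.
have [n0|n_gt0] := posnP #|` A|.
  rewrite n0 eps0 subr0 powR0; last by rewrite pnatr_eq0.
  split=> [|M M0 _]; first exact: ler0n.
  by exists 3; split; rewrite ?lexx ?mulr0 ?le_max ?ler0n //.
have AX a y : a \in A -> y \in Y -> a + y \in X by exact: in_imfset2.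
have AY a a' : a \in A -> a' \in A -> a * a' \in Y by exact: in_imfset2.
have AS a a' : a \in A -> a' \in A -> a + a' \in S by exact: in_imfset2.
have Y1 : (1 <= #|` Y|)%N.
  have /fset0Pn[a aA] : A != fset0 by rewrite -cardfs_gt0.
  by rewrite cardfs_gt0; apply/fset0Pn; exists (a * a); apply: AY.
have X1 : (1 <= #|` X|)%N.
  have /fset0Pn[a aA] : A != fset0 by rewrite -cardfs_gt0.
  by rewrite cardfs_gt0; apply/fset0Pn; exists (a + a * a); apply/AX/AY.
have invM (M : R) : 0 < M -> M `^ (- 3) = (M ^+ 3)^-1.
  by move=> M0; rewrite powRN powR_mulrn // ltW.
(* all powers of |A| = 1 are 1, so here nothing can be hidden in eps *)
have [n1|n1] := eqVneq #|` A| 1%N.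
  rewrite n1 powR1; split=> [|M M0 XM]; first by rewrite ler1n.
  exists 3; split; first by rewrite lexx andbT ler0n.
  have M1 : 1 <= M.
    by move: XM; rewrite expr1n mulr1; apply: le_trans; rewrite ler1n.
  rewrite mulr1 invM //; apply: (@le_trans _ _ 1).
    by rewrite invf_le1 ?exprn_gt0 // exprn_ege1.
  by rewrite le_max ler1n Y1.
have {n1} n_gt1 : (1 < #|` A|)%N by lia.
set n := #|` A| in n_gt0 n_gt1 *.
set L := dyadic_depth n.
have L0 : (0 < L)%N by rewrite /L /dyadic_depth; lia.
have Yn : (#|` Y| <= n * n)%N by exact: card_prodset_le.
have Sn : (#|` S| <= n * n)%N by exact: card_sumset_le.
have Xn : (#|` X| <= n * (n * n))%N.
  by apply: leq_trans (card_sumset_le _ _) _; rewrite leq_mul2l Yn orbT.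
have cube : (n * n <= n ^ 3)%N by rewrite !expnS muln1 leq_mul2l leq_pmulr ?orbT.
have S3 : (#|` S| <= n ^ 3)%N by apply: leq_trans Sn cube.
have Y3 : (#|` Y| <= n ^ 3)%N by apply: leq_trans Yn cube.
have X3 : (#|` X| <= n ^ 3)%N by rewrite !expnS expn0 muln1.
have A3 : (n <= n ^ 3)%N by apply: leq_trans cube; rewrite leq_pmulr.
have AL : (#|` A| + #|` S| <= 2 ^ L)%N.
  by apply: dyadic_depth_bound; rewrite mul2n -addnn leq_add.
have XL : (#|` Y| + #|` X| <= 2 ^ L)%N.
  by apply: dyadic_depth_bound; rewrite mul2n -addnn leq_add.
have [N [B [[N0 B0 nN NB] [YN NN energy]]]] :=
  sum_product_counts n_gt0 (fset_uniq A) A0 k1 L0 (fun a => supp_le hk)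
    (fset_uniq Y) (fset_uniq X) AS AY AX AL XL.
pose G := ((2 * k * L * (2 * k) ^ k) ^ k * (2 * k) ^ k)%N.
pose l := (2 * L ^ k)%N; pose c := (3 * (2 * L) ^ k)%N.
have GE : G = (g * L ^ k)%N.
  by rewrite /G /g -!mulnA [(L * _)%N]mulnC !mulnA expnMn mulnAC.
have lossE : (320 * q ^ 4 * l ^ 4 * c ^ 3 * G ^ 8 = C * L ^ (15 * k))%N.
  have collect x y u v : (320 * u ^ 4 * (2 * x) ^ 4 * (3 * (y * x)) ^ 3 * (v * x) ^ 8 =
      320 * u ^ 4 * 2 ^ 4 * (3 * y) ^ 3 * v ^ 8 * x ^ 15)%N by ring.
  by rewrite /C /l /c GE [(15 * k)%N]mulnC [in RHS]expnM (expnMn 2 L k) collect.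
have Lk0 : (0 < L ^ k)%N by rewrite expn_gt0 L0.
have q1 : (1 : R) <= q%:R by rewrite ler1n.
have l1 : (1 : R) <= l%:R by rewrite ler1n muln_gt0 Lk0.
have c1 : (1 : R) <= c%:R by rewrite ler1n muln_gt0 expn_gt0 muln_gt0 L0.
have G1 : (1 : R) <= G%:R by rewrite ler1n GE muln_gt0 g0 Lk0.
have N0R : (0 : R) < N%:R by rewrite ltr0n.
have B0R : (0 : R) < B%:R by rewrite ltr0n.
have Y0R : (0 : R) < #|` Y|%:R by rewrite ltr0n.
have nNR : n%:R <= G%:R * N%:R :> R by rewrite -natrM ler_nat.
have NBR : N%:R * B%:R <= q%:R * #|` Y|%:R :> R by rewrite -!natrM ler_nat.
have YNR : #|` Y|%:R * N%:R <= l%:R * B%:R * #|` X|%:R :> R by rewrite -!natrM ler_nat.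
have NNR : N%:R * N%:R <= l%:R * B%:R * #|` S|%:R :> R by rewrite -!natrM ler_nat.
have energyR (K : nat) : (0 < K)%N -> K%:R * (#|` Y|%:R * N%:R) ^+ 2 <=
    2 * #|` X|%:R * l%:R * (#|` Y|%:R * (K%:R * N%:R + c%:R *
      (N%:R * B%:R + K%:R ^+ 3 * B%:R ^+ 2))) :> R.
  move=> /energy; rewrite -/c -(ler_nat R) !(natrM, natrD, natrX) => e.
  by apply: le_trans e _; lra.
have lossR : C%:R * L%:R ^+ (15 * k) =
    320 * q%:R ^+ 4 * l%:R ^+ 4 * c%:R ^+ 3 * G%:R ^+ 8 :> R.
  by rewrite -natrX -natrM -lossE !(natrM, natrX).
have loss0 : 0 < C%:R * L%:R ^+ (15 * k) :> R.
  by rewrite mulr_gt0 ?exprn_gt0 ?ltr0n // -(ltr_nat R) (lt_le_trans _ C1).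
rewrite epsE // -/L; split=> [|M M0 XM].
  rewrite ler_pdivrMr // lossR.
  have [_] := first_bound (ler0n R n) N0R B0R (lt_le_trans ltr01 q1) (lt_le_trans ltr01 l1) nNR NBR YNR.
  move/le_trans; apply; rewrite [X in _ <= X]mulrC ler_wpM2r //.
  have c3 : 1 <= 320 * c%:R ^+ 3 :> R by rewrite mulr_ege1 ?exprn_ege1 // ler1n.
  have low : G%:R ^+ 2 * q%:R * l%:R <= G%:R ^+ 8 * q%:R ^+ 4 * l%:R ^+ 4 :> R.
    rewrite ler_pM ?mulr_ge0 ?exprn_ge0 ?ler0n ?ler_eXnr //.
    by rewrite ler_pM ?exprn_ge0 ?ler0n ?ler_eXnr // ler_weXn2l.
  apply: le_trans low _; set u : R := _ * _.
  have u0 : 0 <= u by rewrite !mulr_ge0 ?exprn_ge0 ?ler0n.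
  have := ler_wpM2r u0 c3; rewrite /u; lra.
exists 3; split; first by rewrite lexx andbT ler0n.
have main := second_bound (ler0n R n) N0R B0R q1 l1 c1 Y0R (ler0n R _) (ler0n R _)
  nNR NBR YNR NNR energyR XM.
rewrite invM // mulrA ler_pdivrMr // mulrC ler_pdivrMr ?exprn_gt0 //.
by apply: le_trans main _; rewrite lossR; lra.
Qed.
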